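(* Let $p_{XYZ}$ be a joint distribution on finite sets $\mathcal X\times\mathcal Y\times\mathcal Z$ in normal form. Any secure sampling protocol $\Pi(p_{XYZ})$ satisfies \begin{align*} H(M_{23})&\ge RI(X;Z)+RI(X;Y)+H(Y,Z|X),\\ H(M_{31})&\ge RI(Y;Z)+RI(X;Y)+H(X,Z|Y),\\ H(M_{12})&\ge RI(X;Z)+RI(Y;Z)+H(X,Y|Z). \end{align*}
   Context: Secure sampling: three parties Alice (1), Bob (2), Charlie (3) receive no inputs; each has private randomness (no shared randomness), they exchange messages over multiple rounds on three pairwise private links (each message a codeword of a prefix-free code determined by previous messages on that link; termination with probability 1), and at the end Alice outputs $X$, Bob $Y$, Charlie $Z$. $M_{12},M_{23},M_{31}$ are the final transcripts on the Alice–Bob, Bob–Charlie, Charlie–Alice links. The protocol $\Pi(p_{XYZ})$ is a secure sampling protocol for $p_{XYZ}$ if $(X,Y,Z)\sim p_{XYZ}$ and the Markov chains $(M_{12},M_{31})-X-(Y,Z)$, $(M_{12},M_{23})-Y-(X,Z)$, $(M_{23},M_{31})-Z-(X,Y)$ hold. Normal form: $p_{XYZ}$ is in normal form if whenever $x,x'$ satisfy $p(x,y,z)=c\,p(x',y,z)$ for all $y,z$ for some constant $c\ge0$ then $x=x'$, and similarly for $y,y'$ and for $z,z'$. Residual information: $RI(U;V)=I(U;V)-H(U\sqcap V)$, where $U\sqcap V$ has maximum entropy among random variables of the form $f(U)=g(V)$ for deterministic $f,g$. *)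

(* Defs.v *)
From HB Require Import structures.
From mathcomp Require Import all_boot all_order all_algebra.
From mathcomp Require Import all_classical all_reals all_analysis.

Set Implicit Arguments.
Unset Strict Implicit.
Unset Printing Implicit Defensive.

Import Order.TTheory GRing.Theory Num.Theory.
Local Open Scope classical_set_scope.
Local Open Scope ring_scope.

Section FiniteInfo.
Variable R : realType.

Definition is_pmf (T : finType) (q : T -> R) : Prop :=
  (forall t, 0 <= q t) /\ \sum_(t : T) q t = 1.

(* Shannon entropy of a pmf on a finite type (with 0 ln 0 = 0) *)
Definition Hfin (T : finType) (q : T -> R) : R :=
  - \sum_(t : T) q t * ln (q t).

Definition margL (U V : finType) (q : U * V -> R) (u : U) : R :=
  \sum_(v : V) q (u, v).
Definition margR (U V : finType) (q : U * V -> R) (v : V) : R :=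
  \sum_(u : U) q (u, v).

Definition MI (U V : finType) (q : U * V -> R) : R :=
  Hfin (margL q) + Hfin (margR q) - Hfin q.

(* entropy of the random variable f(U), U ~ qU, f : U -> nat
   (any finite-valued function can be relabelled into nat) *)
Definition Hfun (U : finType) (qU : U -> R) (f : U -> nat) : R :=
  - \sum_(n <- undup [seq f u | u <- enum U])
      (\sum_(u | f u == n) qU u) * ln (\sum_(u | f u == n) qU u).

Definition GK (U V : finType) (q : U * V -> R) : R :=
  sup [set e | exists (f : U -> nat) (g : V -> nat),
                 (forall u v, 0 < q (u, v) -> f u = g v) /\
                 e = Hfun (margL q) f].

Definition RI (U V : finType) (q : U * V -> R) : R := MI q - GK q.

End FiniteInfo.

Section Marginals.
Variables (R : realType) (X Y Z : finType) (p : X * Y * Z -> R).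
Definition pX (x : X) : R := \sum_(yz : Y * Z) p (x, yz.1, yz.2).
Definition pY (y : Y) : R := \sum_(xz : X * Z) p (xz.1, y, xz.2).
Definition pZ (z : Z) : R := \sum_(xy : X * Y) p (xy.1, xy.2, z).
Definition pXY (xy : X * Y) : R := \sum_(z : Z) p (xy.1, xy.2, z).
Definition pXZ (xz : X * Z) : R := \sum_(y : Y) p (xz.1, y, xz.2).
Definition pYZ (yz : Y * Z) : R := \sum_(x : X) p (x, yz.1, yz.2).

Definition normal_form : Prop :=
  (forall x x' : X, (exists c : R, 0 <= c /\
       forall y z, p (x, y, z) = c * p (x', y, z)) -> x = x') /\
  (forall y y' : Y, (exists c : R, 0 <= c /\
       forall x z, p (x, y, z) = c * p (x, y', z)) -> y = y') /\
  (forall z z' : Z, (exists c : R, 0 <= c /\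
       forall x y, p (x, y, z) = c * p (x, y, z')) -> z = z').
End Marginals.

(* Parties: 1 = Alice (output in X), 2 = Bob (Y), 3 = Charlie (Z).      *)
(* Synchronous rounds; in each round every party that has not yet       *)
(* halted either halts (choosing its output) or sends one (possibly     *)
(* empty) bit string to each of the two other parties.  Private         *)
(* randomness is modelled by each party drawing its move from a         *)
(* probability kernel that depends only on that party's own view.       *)
Definition bits := seq bool.

(* a move of a party with output type O:
   inl (inl o)      = halt with output o
   inl (inr (a, b)) = send a to the lower-indexed other party and
                      b to the higher-indexed other party
   inr tt           = idle (only after having halted) *)
Definition move (O : Type) := ((O + (bits * bits)) + unit)%type.
Definition Halt {O} (o : O) : move O := inl (inl o).
Definition Send {O} (a b : bits) : move O := inl (inr (a, b)).
Definition Idle {O} : move O := inr tt.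

Definition is_halt {O} (m : move O) : bool :=
  if m is inl (inl _) then true else false.
Definition is_idle {O} (m : move O) : bool :=
  if m is inr _ then true else false.
Definition msg1 {O} (m : move O) : bits :=
  if m is inl (inr (a, _)) then a else [::].
Definition msg2 {O} (m : move O) : bits :=
  if m is inl (inr (_, b)) then b else [::].
Fixpoint first_halt {O} (ms : seq (move O)) : option O :=
  match ms with
  | [::] => None
  | inl (inl o) :: _ => Some o
  | _ :: t => first_halt t
  end.

Definition prefix_free (C : set bits) : Prop :=
  forall u v, C u -> C v -> prefix u v -> u = v.

Section Protocol.
Variables (R : realType) (X Y Z : finType).

Definition round := (move X * move Y * move Z)%type.
Definition history := seq round.

Definition mA (r : round) : move X := r.1.1.
Definition mB (r : round) : move Y := r.1.2.
Definition mC (r : round) : move Z := r.2.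

(* directed messages of a round: mij = message from party i to party j *)
Definition m12 (r : round) := msg1 (mA r).
Definition m13 (r : round) := msg2 (mA r).
Definition m21 (r : round) := msg1 (mB r).
Definition m23 (r : round) := msg2 (mB r).
Definition m31 (r : round) := msg1 (mC r).
Definition m32 (r : round) := msg2 (mC r).

Definition viewA (h : history) := [seq (mA r, m21 r, m31 r) | r <- h].
Definition viewB (h : history) := [seq (mB r, m12 r, m32 r) | r <- h].
Definition viewC (h : history) := [seq (mC r, m13 r, m23 r) | r <- h].

Definition link12 (h : history) := [seq (m12 r, m21 r) | r <- h].
Definition link23 (h : history) := [seq (m23 r, m32 r) | r <- h].
Definition link31 (h : history) := [seq (m31 r, m13 r) | r <- h].

Definition tr12 (h : history) : bits := flatten [seq m12 r ++ m21 r | r <- h].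
Definition tr23 (h : history) : bits := flatten [seq m23 r ++ m32 r | r <- h].
Definition tr31 (h : history) : bits := flatten [seq m31 r ++ m13 r | r <- h].

Definition haltedA (h : history) := has (fun r => is_halt (mA r)) h.
Definition haltedB (h : history) := has (fun r => is_halt (mB r)) h.
Definition haltedC (h : history) := has (fun r => is_halt (mC r)) h.
Definition all_halted (h : history) := [&& haltedA h, haltedB h & haltedC h].

Definition terminal (h : history) : bool :=
  all_halted h && ~~ all_halted (take (size h).-1 h).

Definition outA (h : history) : option X := first_halt (map mA h).
Definition outB (h : history) : option Y := first_halt (map mB h).
Definition outC (h : history) : option Z := first_halt (map mC h).

Record protocol := Protocol {
  kerA : seq (move X * bits * bits) -> move X -> R;
  kerB : seq (move Y * bits * bits) -> move Y -> R;
  kerC : seq (move Z * bits * bits) -> move Z -> R }.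

Variable P : protocol.

Definition stepA (h : history) (m : move X) : R :=
  if haltedA h then (if is_idle m then 1 else 0) else kerA P (viewA h) m.
Definition stepB (h : history) (m : move Y) : R :=
  if haltedB h then (if is_idle m then 1 else 0) else kerB P (viewB h) m.
Definition stepC (h : history) (m : move Z) : R :=
  if haltedC h then (if is_idle m then 1 else 0) else kerC P (viewC h) m.

(* the parties choose their moves independently given their views *)
Definition rstep (h : history) (r : round) : R :=
  stepA h (mA r) * stepB h (mB r) * stepC h (mC r).

Definition hprob (h : history) : R :=
  \prod_(i < size h) rstep (take i h) (nth (Idle, Idle, Idle) h i).

Definition Pr (E : set history) : \bar R :=
  \esum_(h in [set h | terminal h] `&` E) (hprob h)%:E.

Definition kernel_ok (V : Type) (O : choiceType) (k : V -> move O -> R) : Prop :=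
  forall v, (forall m, 0 <= k v m) /\ k v Idle = 0 /\
            (\esum_(m in [set: move O]) (k v m)%:E = 1)%E.

Definition codes_ok : Prop :=
  exists c12 c21 c23 c32 c31 c13 : seq (bits * bits) -> set bits,
    (forall l, prefix_free (c12 l)) /\ (forall l, prefix_free (c21 l)) /\
    (forall l, prefix_free (c23 l)) /\ (forall l, prefix_free (c32 l)) /\
    (forall l, prefix_free (c31 l)) /\ (forall l, prefix_free (c13 l)) /\
    forall h r, 0 < hprob h -> ~~ all_halted h -> 0 < rstep h r ->
      [/\ c12 (link12 h) (m12 r), c21 (link12 h) (m21 r),
          c23 (link23 h) (m23 r) & c32 (link23 h) (m32 r)] /\
      c31 (link31 h) (m31 r) /\ c13 (link31 h) (m13 r).

Definition terminates : Prop := Pr setT = 1%E.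

Definition valid_protocol : Prop :=
  [/\ kernel_ok (kerA P), kernel_ok (kerB P), kernel_ok (kerC P),
      codes_ok & terminates].

Definition outs (h : history) (x : X) (y : Y) (z : Z) : Prop :=
  [/\ outA h = Some x, outB h = Some y & outC h = Some z].

Definition ent (T : choiceType) (q : T -> R) : \bar R :=
  \esum_(t in [set: T]) (- (q t * ln (q t)))%:E.

Definition H12 : \bar R := ent (fun m : bits => fine (Pr [set h | tr12 h = m])).
Definition H23 : \bar R := ent (fun m : bits => fine (Pr [set h | tr23 h = m])).
Definition H31 : \bar R := ent (fun m : bits => fine (Pr [set h | tr31 h = m])).

Definition secure_sampling (p : X * Y * Z -> R) : Prop :=
  valid_protocol /\
  (forall x y z, Pr [set h | outs h x y z] = (p (x, y, z))%:E) /\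
  (* (M12, M31) - X - (Y, Z) *)
  (forall x y z a c,
     (Pr [set h | outs h x y z /\ tr12 h = a /\ tr31 h = c] *
      Pr [set h | outA h = Some x])%E =
     (Pr [set h | outA h = Some x /\ tr12 h = a /\ tr31 h = c] *
      Pr [set h | outs h x y z])%E) /\
  (* (M12, M23) - Y - (X, Z) *)
  (forall x y z a b,
     (Pr [set h | outs h x y z /\ tr12 h = a /\ tr23 h = b] *
      Pr [set h | outB h = Some y])%E =
     (Pr [set h | outB h = Some y /\ tr12 h = a /\ tr23 h = b] *
      Pr [set h | outs h x y z])%E) /\
  (* (M23, M31) - Z - (X, Y) *)
  (forall x y z b c,
     (Pr [set h | outs h x y z /\ tr23 h = b /\ tr31 h = c] *
      Pr [set h | outC h = Some z])%E =
     (Pr [set h | outC h = Some z /\ tr23 h = b /\ tr31 h = c] *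
      Pr [set h | outs h x y z])%E).

End Protocol.

(* Main.v *)
Require Import Defs.
From HB Require Import structures.
From mathcomp Require Import all_boot all_order all_algebra.
From mathcomp Require Import all_classical all_reals all_analysis.
From mathcomp Require Import ring lra.
Import Order.TTheory GRing.Theory Num.Theory.
Import numFieldNormedType.Exports.
Set Implicit Arguments.
Unset Strict Implicit.
Unset Printing Implicit Defensive.
Local Open Scope classical_set_scope.
Local Open Scope ring_scope.

(* Let A, B, C be the transcripts of the links 12, 23, 31. By privacy and the
   normal form each output is a function of the two transcripts that its party
   sees. Decompose H(B) = I(A;B) + I(B;C|A) + H(B|AC). The last term is at least
   H(Y,Z|X). The middle one is at least I(X;Y|A) >= I(X;Y) - I(Y;A), and privacy
   makes A independent of X given Y and of Y given X, so that I(Y;A) is at most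
   the common information of X and Y: this gives RI(X;Y). In the same way
   I(A;B|C) >= RI(X;Z), and I(A;B) >= I(A;B|C) because the parties share no
   randomness: the interaction information is 0 before the first round and each
   message, being generated from the two links of its sender, does not decrease
   it. As transcripts are unbounded, this last inequality is proved after n
   rounds and transferred to the outputs, which are known after n rounds with
   probability tending to 1. *)

(** * Sums of nonnegative families *)

(** Transcripts range over infinite sets. H(B) may be infinite, and H(A) and H(C) may be infinite
    even when H(B) is finite. Informations between transcripts are therefore written through
    conditional entropies of one variable, in additive form, and real arithmetic starts only once
    the case H(B) = +oo is set aside. No limit of entropies of truncated transcripts is taken: the
    inequality after n rounds is used only through guesses of the outputs made from the truncated
    transcripts. These have a finite range, so Fano's bound gives an error that depends on n only
    through the probability of a wrong guess. The independence facts that do not come from privacy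
    come from one cut-and-paste argument: two runs that agree on the links separating some parties
    from the others may exchange the moves of these parties without changing the product of their
    probabilities. Applied within a round it drives the interaction inequality; applied to finished
    runs it shows that the outputs are determined by the transcripts. *)

Section EsumExtra.
Variable R : realType.

Lemma ge0_esumZl (T : choiceType) (D : set T) (c : R) (a : T -> \bar R) :
  0 <= c -> (forall i, (0 <= a i)%E) ->
  (\esum_(i in D) (c%:E * a i) = c%:E * \esum_(i in D) a i)%E.
Proof.
have le (c' : R) (a' : T -> \bar R) : 0 <= c' -> (forall i, (0 <= a' i)%E) ->
  (\esum_(i in D) (c'%:E * a' i) <= c'%:E * \esum_(i in D) a' i)%E.
  move=> c0 a0; apply: ge_ereal_sup => /= _ [X [finX XD] <-].
  rewrite -ge0_mule_fsumr//.
  apply: lee_pmul => //; first by apply: fsume_ge0.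
  by apply: esum_ge; exists X.
move=> c0 a0; apply/eqP; rewrite eq_le le//=.
have [->|cn0] := eqVneq c 0.
  by rewrite mul0e; apply: esum_ge0 => i _; rewrite mul0e.
have cgt0 : 0 < c by rewrite lt_neqAle eq_sym cn0.
(* The one-sided bound [le], applied with the inverse of [c], gives the opposite inequality. *)
rewrite -[leRHS]mul1e -(divff cn0) EFinM -muleA.
apply: lee_pmul => //; first by apply: esum_ge0.
apply: le_trans (le _ _ _ _); rewrite ?invr_ge0//.
  apply: le_esum => i _; rewrite muleA -EFinM mulVf// mul1e//.
by move=> i; apply: mule_ge0; rewrite ?lee_fin.
Qed.

Lemma exchange_esum (S T : choiceType) (P : S -> T -> Prop) (a : S -> T -> \bar R) :
  (forall i j, (0 <= a i j)%E) ->
  (\esum_(i in setT) \esum_(j in [set j | P i j]) a i j =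
   \esum_(j in setT) \esum_(i in [set i | P i j]) a i j)%E.
Proof.
move=> a0; rewrite !esum_esum//.
rewrite (reindex_esum (setT `*`` (fun j => [set i | P i j])) _
  (fun k => (k.2, k.1)))//.
split => //=.
- by move=> [j i] [j' i'] _ _ /= [-> ->].
- by move=> [i j] /= [_ Pij]; exists (j, i).
Qed.

Lemma esum_fiber (S T : choiceType) (D : set S) (f : S -> T) (a : S -> \bar R) :
  (forall i, (0 <= a i)%E) ->
  (\esum_(i in D) a i = \esum_(t in setT) \esum_(i in D `&` [set i | f i = t]) a i)%E.
Proof.
move=> a0; rewrite (exchange_esum (fun t i => D i /\ f i = t) (a := fun _ i => a i))//.
rewrite esum_mkcond; apply: eq_esum => i _; case: ifPn => iD.
  rewrite (_ : [set t | _] = [set f i]) ?esum_set1//.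
  by apply/seteqP; split => [t [] //|t /= ->]; rewrite inE in iD.
rewrite (_ : [set t | _] = set0) ?esum_set0//.
by apply/seteqP; split => // t [/mem_set]; rewrite (negbTE iD).
Qed.

Lemma esum_fiber_seq (S T : choiceType) (D : set S) (s : seq T) (f : S -> T)
  (a : S -> \bar R) :
  (forall i, (0 <= a i)%E) -> uniq s -> (forall i, D i -> f i \in s) ->
  (\esum_(i in D) a i = \sum_(t <- s) \esum_(i in D `&` [set i | f i = t]) a i)%E.
Proof.
move=> a0 us sf.
under [RHS]eq_bigr do rewrite esum_mkcondr.
rewrite -(@esum_sum _ _ _ D s xpredT
  (fun i t => if i \in [set i | f i = t] then a i else 0%E)); last first.
  by move=> i j _ _; case: ifP.
apply: eq_esum => i Di.
rewrite (bigD1_seq (f i)) ?sf//= mem_set//=.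
rewrite big1 ?adde0// => t tf.
by rewrite memNset//= => ft; rewrite -ft eqxx in tf.
Qed.

Lemma esum_fiber_fin (S : choiceType) (T : finType) (D : set S) (f : S -> T)
  (a : S -> \bar R) : (forall i, (0 <= a i)%E) ->
  (\esum_(i in D) a i = \sum_t \esum_(i in D `&` [set i | f i = t]) a i)%E.
Proof.
move=> a0; rewrite (esum_fiber_seq (s := index_enum T) (f := f))//.
  exact: index_enum_uniq.
by move=> i _; rewrite mem_index_enum.
Qed.

Lemma esum_subset (S : choiceType) (A B : set S) (a : S -> \bar R) :
  (forall i, (0 <= a i)%E) -> A `<=` B -> (\esum_(i in A) a i <= \esum_(i in B) a i)%E.
Proof.
move=> a0 AB; rewrite [leLHS]esum_mkcond [leRHS]esum_mkcond; apply: le_esum => i _.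
case: ifPn => // iA; first by rewrite mem_set//; apply: AB; rewrite inE in iA.
by case: ifP.
Qed.

End EsumExtra.

(** * Entropy of random variables on a discrete probability space *)

(* Random variables are plain functions on the sample space, with any codomain:
   every entropy below only depends on the fibres of the functions restricted
   to the support of [mu]. *)
Definition jnt (W S T : Type) (f : W -> S) (g : W -> T) (w : W) : S * T := (f w, g w).
Notation "f '&&&' g" := (jnt f g) (at level 50, left associativity).

Definition const_rv (W : Type) (w : W) : unit := tt.

Ltac solve_det := by let x := fresh in let y := fresh in let e := fresh in
  intros x y _ _ e; unfold jnt, const_rv in *; congruence.

Section Probability.
Variables (R : realType) (W : choiceType) (mu : W -> R).

Definition prob (E : set W) : R := fine (\esum_(w in E) (mu w)%:E).

Definition fiber_prob (T : Type) (f : W -> T) (w : W) : R := prob [set w' | f w' = f w].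

(** Almost sure functional dependence, stated on pairs of sample points so that no factoring map has
    to be produced. *)
Definition det (S T : Type) (g : W -> S) (f : W -> T) : Prop :=
  forall w w', 0 < mu w -> 0 < mu w' -> g w = g w' -> f w = f w'.

(** This is -ln P(f | g) at the point [w]. It is nonnegative on the support, so its average makes
    sense as a possibly infinite sum. *)
Definition surprisal (S T : Type) (f : W -> S) (g : W -> T) (w : W) : R :=
  ln (fiber_prob g w / fiber_prob (f &&& g) w).

Definition cond_entropy (S T : Type) (f : W -> S) (g : W -> T) : \bar R :=
  \esum_(w in setT) (mu w * surprisal f g w)%:E.

(** The factorisation is asked on the support only, which is all that entropies see. *)
Definition cind (S T U : Type) (f : W -> S) (g : W -> T) (k : W -> U) : Prop :=
  forall w, 0 < mu w ->
    fiber_prob (f &&& g &&& k) w * fiber_prob k w =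
    fiber_prob (f &&& k) w * fiber_prob (g &&& k) w.

Hypothesis mu_ge0 : forall w, 0 <= mu w.
Hypothesis mu_sum : (\esum_(w in setT) (mu w)%:E = 1)%E.

Let muE0 w : (0 <= (mu w)%:E)%E. Proof. by rewrite lee_fin. Qed.
Hint Resolve muE0 : core.

Lemma prE E : (prob E)%:E = (\esum_(w in E) (mu w)%:E)%E.
Proof.
rewrite /prob fineK// ge0_fin_numE ?esum_ge0//.
apply: le_lt_trans (esum_subset _ (subsetT _)) _; rewrite ?mu_sum ?ltry//.
Qed.

Lemma pr_ge0 E : 0 <= prob E.
Proof. by rewrite -lee_fin prE esum_ge0. Qed.

Lemma pr_le E F : E `<=` F -> prob E <= prob F.
Proof. by move=> EF; rewrite -lee_fin !prE; apply: esum_subset. Qed.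

Lemma prT : prob setT = 1.
Proof. by rewrite /prob mu_sum. Qed.

Lemma pr_le1 E : prob E <= 1.
Proof. by rewrite -prT pr_le. Qed.

Lemma pr_supp E F : (forall w, 0 < mu w -> E w <-> F w) -> prob E = prob F.
Proof.
move=> EF; apply: EFin_inj; rewrite !prE [LHS]esum_mkcond [RHS]esum_mkcond.
apply: eq_esum => w _; have [mw|mw] := ltP 0 (mu w).
  by have /propext EFw := EF w mw; congr (if _ then _ else _); apply/idP/idP;
  rewrite !inE ?EFw// -EFw.
have -> : mu w = 0 by apply/eqP; rewrite eq_le mw mu_ge0.
by rewrite !if_same.
Qed.

Lemma mu_le_pr (E : set W) w : E w -> mu w <= prob E.
Proof.
move=> Ew; rewrite -lee_fin prE -(esum_set1 (a := fun w => (mu w)%:E))//.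
by apply: esum_subset => // _ ->.
Qed.

Lemma pr_gt0 (E : set W) w : E w -> 0 < mu w -> 0 < prob E.
Proof. by move=> /mu_le_pr + m0; apply: lt_le_trans. Qed.

Lemma pr_gt0_ex (E : set W) : 0 < prob E -> exists2 w, 0 < mu w & E w.
Proof.
move=> E0; apply: contrapT => nE; suff : prob E = 0 by move=> EE; rewrite EE ltxx in E0.
have <- : prob set0 = 0 by rewrite /prob esum_set0.
apply: pr_supp => w mw; split => // Ew.
by exfalso; apply: nE; exists w.
Qed.

Lemma prID E F : prob E = prob (E `&` F) + prob (E `&` ~` F).
Proof. by apply: EFin_inj; rewrite EFinD !prE (esumID F). Qed.

Lemma pr_fiber (T : finType) (f : W -> T) E :
  prob E = \sum_t prob (E `&` [set w | f w = t]).
Proof.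
apply: EFin_inj; rewrite prE (esum_fiber_fin E f)// -sumEFin.
by apply: eq_bigr => t _; rewrite prE.
Qed.

Lemma pf_gt0 (T : Type) (f : W -> T) w : 0 < mu w -> 0 < fiber_prob f w.
Proof. exact: pr_gt0. Qed.

Lemma pf_le (S T : Type) (f : W -> S) (g : W -> T) w :
  det f g -> 0 < mu w -> fiber_prob f w <= fiber_prob g w.
Proof.
move=> fg mw; rewrite /fiber_prob.
rewrite (_ : prob _ = prob [set w' | f w' = f w /\ g w' = g w]).
  by apply: pr_le => w' [].
apply: pr_supp => w' mw'; split => [/= e|[]//]; split => //.
exact: fg.
Qed.

Lemma pf_eq (S T : Type) (f : W -> S) (g : W -> T) w :
  det f g -> det g f -> 0 < mu w -> fiber_prob f w = fiber_prob g w.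
Proof. by move=> fg gf mw; apply/eqP; rewrite eq_le !pf_le. Qed.

Lemma surprisal_ge0 (S T : Type) (f : W -> S) (g : W -> T) w :
  0 < mu w -> 0 <= surprisal f g w.
Proof.
move=> mw; apply: ln_ge0; rewrite ler_pdivlMr ?mul1r ?pf_gt0//.
by apply: (@pf_le _ _ (f &&& g) g) => // x y _ _ [].
Qed.

Lemma mu_or w : mu w = 0 \/ 0 < mu w.
Proof. by have := mu_ge0 w; rewrite le_eqVlt => /orP[/eqP/esym|]; auto. Qed.

Lemma esum_mu_le (u v : W -> R) : (forall w, 0 < mu w -> u w <= v w) ->
  (\esum_(w in setT) (mu w * u w)%:E <= \esum_(w in setT) (mu w * v w)%:E)%E.
Proof.
move=> uv; apply: le_esum => w _; have [->|mw] := mu_or w.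
  by rewrite !mul0r.
by rewrite lee_fin ler_pM2l// uv.
Qed.

Lemma esum_mu_eq (u v : W -> R) : (forall w, 0 < mu w -> u w = v w) ->
  (\esum_(w in setT) (mu w * u w)%:E = \esum_(w in setT) (mu w * v w)%:E)%E.
Proof. by move=> uv; apply/eqP; rewrite eq_le !esum_mu_le// => w /uv ->. Qed.

Lemma esum_muD (u v : W -> R) : (forall w, 0 < mu w -> 0 <= u w) ->
  (forall w, 0 < mu w -> 0 <= v w) ->
  (\esum_(w in setT) (mu w * (u w + v w))%:E =
   \esum_(w in setT) (mu w * u w)%:E + \esum_(w in setT) (mu w * v w)%:E)%E.
Proof.
have aux (x : W -> R) w : (forall w, 0 < mu w -> 0 <= x w) -> 0 <= mu w * x w.
  move=> x0; have [->|mw] := mu_or w; first by rewrite mul0r.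
  by rewrite mulr_ge0// x0.
move=> u0 v0; rewrite -esumD; last 2 first.
- by move=> w _; rewrite lee_fin aux.
- by move=> w _; rewrite lee_fin aux.
by apply: eq_esum => w _; rewrite mulrDr.
Qed.

Lemma esum_mu_const (c : R) : 0 <= c ->
  (\esum_(w in setT) (mu w * c)%:E = c%:E)%E.
Proof.
move=> c0; under eq_esum => w _ do rewrite mulrC EFinM.
by rewrite ge0_esumZl// mu_sum mule1.
Qed.

Lemma condH_ge0 (S T : Type) (f : W -> S) (g : W -> T) : (0 <= cond_entropy f g)%E.
Proof.
apply: esum_ge0 => w _; rewrite lee_fin.
have [->|mw] := mu_or w; first by rewrite mul0r.
by rewrite mulr_ge0// surprisal_ge0.
Qed.

Lemma condH_eq (S T S' T' : Type) (f : W -> S) (g : W -> T) (f' : W -> S') (g' : W -> T') :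
  det g g' -> det g' g -> det (f &&& g) f' -> det (f' &&& g') f ->
  cond_entropy f g = cond_entropy f' g'.
Proof.
move=> d1 d2 d3 d4; apply: esum_mu_eq => w mw; rewrite /surprisal.
rewrite (pf_eq d1 d2 mw) (@pf_eq _ _ (f &&& g) (f' &&& g') _ _ _ mw)//.
  by move=> x y mx my [e1 e2]; rewrite /jnt (d1 x y mx my e2) (d3 x y mx my)// /jnt e1 e2.
by move=> x y mx my [e1 e2]; rewrite /jnt (d2 x y mx my e2) (d4 x y mx my)// /jnt e1 e2.
Qed.

Lemma condH_chain (S T U : Type) (f : W -> S) (g : W -> T) (h : W -> U) :
  cond_entropy (f &&& g) h = (cond_entropy f (g &&& h) + cond_entropy g h)%E.
Proof.
rewrite /cond_entropy -esum_muD; try by move=> w mw; exact: surprisal_ge0.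
apply: esum_mu_eq => w mw; rewrite /surprisal.
rewrite (@pf_eq _ _ (f &&& g &&& h) (f &&& (g &&& h)) _ _ _ mw); try solve_det.
rewrite -lnM ?posrE ?divr_gt0 ?pf_gt0//; congr ln.
have := pf_gt0 (f &&& (g &&& h)) mw; have := pf_gt0 (g &&& h) mw.
by move=> p1 p2; field; rewrite !gt_eqF.
Qed.

(** Both sides are the sum of [a w * mu w'] over the pairs lying in one fibre of [k]. *)
Lemma exchange_pf (T : Type) (k : W -> T) (a : W -> R) : (forall w, 0 <= a w) ->
  (\esum_(w in setT) (a w * fiber_prob k w)%:E =
   \esum_(w' in setT) ((mu w')%:E * \esum_(w in [set w | k w = k w']) (a w)%:E))%E.
Proof.
move=> a0.
transitivity (\esum_(w in setT) \esum_(w' in [set w' | k w' = k w]) (mu w' * a w)%:E)%E.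
  apply: eq_esum => w _; rewrite EFinM prE -ge0_esumZl//.
  by apply: eq_esum => w' _; rewrite mulrC.
rewrite (@exchange_esum R W W (fun w w' => k w' = k w) (fun w w' => (mu w' * a w)%:E)); last first.
  by move=> w w'; rewrite lee_fin mulr_ge0.
apply: eq_esum => w' _; rewrite -ge0_esumZl//.
rewrite (_ : [set i | k w' = k i] = [set w | k w = k w']); last by apply/seteqP; split.
by apply: eq_esum => w _; rewrite EFinM.
Qed.


(* [gibbs] is the Gibbs inequality behind the nonnegativity of I(F;H|G); the
   cell is the part of its triple sum where two of the three points are fixed. *)
Lemma gibbs_cell (S T U : Type) (f : W -> S) (g : W -> T) (h : W -> U) w' w'' :
  (\esum_(w in [set w | (f &&& g) w = (f &&& g) w'' /\ (g &&& h) w = (g &&& h) w'])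
     (mu w / (fiber_prob (f &&& g &&& h) w * fiber_prob g w))%:E
   <= (if w'' \in [set w'' | g w'' = g w'] then (fiber_prob g w')^-1 else 0)%:E)%E.
Proof.
set D := [set w | _].
(* If nonempty, [D] is a single fibre of [f &&& g &&& h], so both denominators are constant on
   it. *)
have DE w : D w -> [/\ g w'' = g w', fiber_prob g w = fiber_prob g w' &
    fiber_prob (f &&& g &&& h) w = prob D].
  move=> [[fw gw] [gw' hw]]; split; first by rewrite -gw.
    by rewrite /fiber_prob gw'.
  rewrite /fiber_prob; congr prob; apply/seteqP; rewrite /D /jnt; split => x /=.
    by move=> [-> -> ->]; rewrite fw gw hw -gw gw'.
  by move=> [[-> ->] [_ ->]]; rewrite fw gw hw.
rewrite (_ : esum _ _ =
  \esum_(w in D) (((prob D)^-1 * (fiber_prob g w')^-1)%:E * (mu w)%:E))%E; last first.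
  by apply: eq_esum => w /DE[_ -> ->]; rewrite -EFinM mulrC invfM.
rewrite ge0_esumZl//; last by rewrite mulr_ge0// invr_ge0 pr_ge0.
rewrite -prE -EFinM lee_fin; case: ifPn => [|gne].
  move=> _; rewrite mulrAC; have [->|D0] := eqVneq (prob D) 0.
    by rewrite mulr0 mul0r invr_ge0 pr_ge0.
  by rewrite mulVf// mul1r.
rewrite (_ : D = set0) ?/prob ?esum_set0 ?mulr0//.
apply/seteqP; split => // w /DE[e _ _]; move/negP: gne; apply.
by rewrite inE.
Qed.

Lemma gibbs (S T U : Type) (f : W -> S) (g : W -> T) (h : W -> U) :
  (\esum_(w in setT) (mu w * (fiber_prob (f &&& g) w * fiber_prob (g &&& h) w /
      (fiber_prob (f &&& g &&& h) w * fiber_prob g w)))%:E <= 1)%E.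
Proof.
have pf0 V (k : W -> V) w : 0 <= fiber_prob k w by exact: pr_ge0.
pose b w := mu w / (fiber_prob (f &&& g &&& h) w * fiber_prob g w).
have b0 w : 0 <= b w by rewrite /b divr_ge0 ?mulr_ge0.
have -> : esum setT (fun w => (mu w * (fiber_prob (f &&& g) w * fiber_prob (g &&& h) w /
      (fiber_prob (f &&& g &&& h) w * fiber_prob g w)))%:E) =
   (\esum_(w in setT) ((b w * fiber_prob (f &&& g) w) * fiber_prob (g &&& h) w)%:E)%E.
  by apply: eq_esum => w _; rewrite /b; congr EFin; ring.
(* Each of the two probabilities in the numerator is expanded by [exchange_pf], into a point [w']
   for [g &&& h] and later a point [w''] for [f &&& g]. The sum over [w] is left for
   [gibbs_cell]. *)
rewrite exchange_pf; last by move=> w; rewrite mulr_ge0.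
rewrite -mu_sum; apply: le_esum => w' _; rewrite -[leRHS]mule1.
apply: lee_pmul => //; first by apply: esum_ge0 => w _; rewrite lee_fin mulr_ge0.
rewrite esum_mkcond.
pose b' w := if w \in [set w | (g &&& h) w = (g &&& h) w'] then b w else 0.
have b'0 w : 0 <= b' w by rewrite /b'; case: ifP.
rewrite (_ : esum _ _ = \esum_(w in setT) (b' w * fiber_prob (f &&& g) w)%:E)%E; last first.
  by apply: eq_esum => w _; rewrite /b'; case: ifP => //; rewrite mul0r.
rewrite exchange_pf//.
apply: (@le_trans _ _ (\esum_(w'' in setT) ((mu w'')%:E *
   (if w'' \in [set w'' | g w'' = g w'] then (fiber_prob g w')^-1 else 0)%:E))%E).
  apply: le_esum => w'' _; apply: lee_pmul => //.
    by apply: esum_ge0 => w _; rewrite lee_fin; exact: b'0.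
  apply: le_trans (gibbs_cell f g h w' w'').
  rewrite [leLHS]esum_mkcond [leRHS]esum_mkcond; apply: le_esum => w _.
  have [c1|c1] := boolP (w \in [set w | (f &&& g) w = (f &&& g) w'']); last first.
    rewrite /=; case: ifP => // _; exact: b0.
  rewrite /b'; have [c2|c2] := boolP (w \in [set w | (g &&& h) w = (g &&& h) w']).
    by rewrite mem_set//=; rewrite !inE in c1 c2.
  by case: ifP => // _; exact: b0.
rewrite (_ : esum _ _ = \esum_(w'' in setT) ((fiber_prob g w')^-1%:E *
   (if w'' \in [set w'' | g w'' = g w'] then (mu w'')%:E else 0)))%E; last first.
  by apply: eq_esum => w _; case: ifP; rewrite ?mule0// muleC.
rewrite ge0_esumZl ?invr_ge0//; last by move=> w; case: ifP.
rewrite -esum_mkcond -prE -EFinM lee_fin -/(fiber_prob g w').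
by have [->|g0] := eqVneq (fiber_prob g w') 0; rewrite ?mulr0// mulVf.
Qed.

(** Gibbs's argument without subtraction: after averaging, only the finite term 1 is cancelled, so
    the averages of [u] and [v] may be infinite. *)
Lemma esum_mu_gibbs (u v r : W -> R) :
  (forall w, 0 < mu w -> 0 <= u w) -> (forall w, 0 < mu w -> 0 <= v w) ->
  (forall w, 0 < mu w -> 0 <= r w) ->
  (\esum_(w in setT) (mu w * r w)%:E <= 1)%E ->
  (forall w, 0 < mu w -> u w + 1 <= v w + r w) ->
  (\esum_(w in setT) (mu w * u w)%:E <= \esum_(w in setT) (mu w * v w)%:E)%E.
Proof.
move=> u0 v0 r0 r1 uvr.
have := esum_mu_le uvr; rewrite !esum_muD// esum_mu_const// => h.
have {h} := le_trans h (leeD2l _ r1).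
by rewrite leeD2rE.
Qed.

Lemma ln_ratio (x y : R) : 0 < x -> 0 < y -> ln x - ln y + 1 <= x / y.
Proof.
move=> x0 y0; rewrite -ln_div ?posrE//.
have h : 0 < x / y by rewrite divr_gt0.
have := @le_ln1Dx _ (x / y - 1); rewrite addrCA subrr addr0 => h'.
rewrite -lerBrDr; apply: h'; lra.
Qed.

(** The two surprisals differ pointwise by the logarithm of the ratio averaged in [gibbs], so ln t
    <= t - 1 suffices. *)
Lemma condH_cond_le (S T U : Type) (f : W -> S) (g : W -> T) (h : W -> U) :
  (cond_entropy f (g &&& h) <= cond_entropy f g)%E.
Proof.
apply: esum_mu_gibbs (gibbs f g h) _.
- by move=> w; exact: surprisal_ge0.
- by move=> w; exact: surprisal_ge0.
- by move=> w _; rewrite !(mulr_ge0, invr_ge0)// pr_ge0.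
move=> w mw; rewrite /surprisal.
rewrite (@pf_eq _ _ (f &&& (g &&& h)) (f &&& g &&& h) _ _ _ mw); try solve_det.
have := pf_gt0 (f &&& g &&& h) mw; have := pf_gt0 (f &&& g) mw.
have := pf_gt0 (g &&& h) mw; have := pf_gt0 g mw.
move: (fiber_prob _ w) (fiber_prob _ w) (fiber_prob _ w) (fiber_prob _ w) => a b c d a0 b0 c0 d0.
rewrite !ln_div ?posrE//.
have := @ln_ratio (c * b) (d * a); rewrite !lnM ?posrE// !mulr_gt0// => /(_ isT isT).
lra.
Qed.

Lemma condH_le (S T S' T' : Type) (f : W -> S) (g : W -> T) (f' : W -> S') (g' : W -> T') :
  det g g' -> det (f' &&& g) f -> (cond_entropy f g <= cond_entropy f' g')%E.
Proof.
move=> gg' f'f.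
apply: (@le_trans _ _ (cond_entropy (f' &&& f) g)).
  by rewrite condH_chain leeDr ?condH_ge0.
apply: le_trans (condH_cond_le f' g' g).
rewrite (@condH_eq _ _ _ _ (f' &&& f) g f' (g' &&& g))//.
- by move=> x y mx my e; rewrite /jnt e (gg' x y).
- by move=> x y _ _ [].
- by move=> x y _ _ [].
- by move=> x y mx my [e1 e2 e3]; rewrite /jnt e1; congr pair; apply: f'f => //; rewrite /jnt e1 e3.
Qed.

Lemma condH_cind (S T U : Type) (f : W -> S) (g : W -> T) (k : W -> U) :
  cind f g k -> cond_entropy f (g &&& k) = cond_entropy f k.
Proof.
move=> fgk; apply: esum_mu_eq => w mw; rewrite /surprisal.
rewrite (@pf_eq _ _ (f &&& (g &&& k)) (f &&& g &&& k) _ _ _ mw); try solve_det.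
congr ln; have := fgk w mw.
move=> e.
apply/eqP; rewrite eqr_div ?(gt_eqF (pf_gt0 _ mw))//.
apply/eqP; lra.
Qed.

Lemma condH_fin (S T : Type) (f : W -> S) (g : W -> T) :
  cond_entropy f (@const_rv W) \is a fin_num -> exists2 r, 0 <= r & cond_entropy f g = r%:E.
Proof.
move=> fin; have fg : cond_entropy f g \is a fin_num.
  rewrite ge0_fin_numE ?condH_ge0//; apply: (@le_lt_trans _ _ (cond_entropy f (@const_rv W))).
    by apply: condH_le; solve_det.
  by rewrite -ge0_fin_numE ?condH_ge0.
exists (fine (cond_entropy f g)); last by rewrite fineK.
by rewrite fine_ge0 ?condH_ge0.
Qed.

(* I(A;S|C) <= I(A;S), rearranged without subtraction: the entropies involved
   may be infinite. *)
Definition interaction (S T U : Type) (a : W -> S) (s : W -> T) (c : W -> U) : Prop :=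
  (cond_entropy s a + cond_entropy s c <=
   cond_entropy s (@const_rv W) + cond_entropy s (a &&& c))%E.

Lemma interaction_sym (S T U : Type) (a : W -> S) (s : W -> T) (c : W -> U) :
  interaction a s c -> interaction c s a.
Proof.
rewrite /interaction addeC => /le_trans; apply; apply: leeD => //.
by apply: condH_le; solve_det.
Qed.

Lemma interaction_eq (S T U S' T' U' : Type) (a : W -> S) (s : W -> T) (c : W -> U)
  (a' : W -> S') (s' : W -> T') (c' : W -> U') :
  det a a' -> det a' a -> det s s' -> det s' s -> det c c' -> det c' c ->
  interaction a s c -> interaction a' s' c'.
Proof.
move=> a1 a2 s1 s2 c1 c2; rewrite /interaction.
rewrite (@condH_eq _ _ _ _ s a s' a')//; last 2 first.
- by move=> x y mx my [/s1]; auto.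
- by move=> x y mx my [/s2]; auto.
rewrite (@condH_eq _ _ _ _ s c s' c')//; last 2 first.
- by move=> x y mx my [/s1]; auto.
- by move=> x y mx my [/s2]; auto.
rewrite (@condH_eq _ _ _ _ s (@const_rv W) s' (@const_rv W))//; last 2 first.
- by move=> x y mx my [/s1]; auto.
- by move=> x y mx my [/s2]; auto.
rewrite (@condH_eq _ _ _ _ s (a &&& c) s' (a' &&& c'))//.
- by move=> x y mx my [e1 e2]; rewrite /jnt (a1 x y)// (c1 x y).
- by move=> x y mx my [e1 e2]; rewrite /jnt (a2 x y)// (c2 x y).
- by move=> x y mx my [/s1]; auto.
- by move=> x y mx my [/s2]; auto.
Qed.

(* The next three lemmas say that the inequality survives one message [d],
   produced from two of the links and hence independent of the third one given
   these two: [d] may be appended to the link not touching the target, to the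
   target, or to a link while the target is the other link of the sender. *)
Lemma interaction_opposite (S T U V : Type) (a : W -> S) (s : W -> T) (c : W -> U) (d : W -> V) :
  cind s d (a &&& c) -> interaction a s c -> interaction (a &&& d) s c.
Proof.
move=> dsac; rewrite /interaction => h.
rewrite (@condH_eq _ _ _ _ s (a &&& d &&& c) s (d &&& (a &&& c))); try solve_det.
rewrite (condH_cind dsac); apply: le_trans h; apply: leeD => //.
by apply: condH_le; solve_det.
Qed.

Lemma interaction_target (S T U V : Type) (a : W -> S) (s : W -> T) (c : W -> U) (d : W -> V) :
  cind d c (a &&& s) -> interaction a s c -> interaction a (d &&& s) c.
Proof.
move=> dcas; rewrite /interaction !condH_chain => h.
have e1 : cond_entropy d (s &&& (a &&& c)) = cond_entropy d (s &&& a).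
  rewrite (@condH_eq _ _ _ _ d (s &&& (a &&& c)) d (c &&& (a &&& s))); try solve_det.
  by rewrite (condH_cind dcas); apply: condH_eq; solve_det.
rewrite e1 addeACA [leRHS]addeACA [leLHS]addeC [leRHS]addeC.
apply: leeD => //; rewrite [leRHS]addeC; apply: leeD => //.
by apply: condH_le; solve_det.
Qed.

Lemma interaction_adjacent (S T U V : Type) (a : W -> S) (s : W -> T) (c : W -> U) (d : W -> V) :
  cind d c (a &&& s) -> interaction a s c -> interaction (a &&& d) s c.
Proof.
move=> dcas; rewrite /interaction => h.
have [sfin|] := boolP (cond_entropy s (@const_rv W) \is a fin_num); last first.
  rewrite ge0_fin_numE ?condH_ge0// ltNge negbK leye_eq => /eqP ->.
  by rewrite addye ?leey// gt_eqF// (lt_le_trans (ltNyr 0)) ?condH_ge0.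
(* This reads I(s;d|a,c) <= I(s;d|a). The gap is I(c;d|a), because I(c;d|a,s) = 0 by [dcas]; hence
   [gibbs d a c]. *)
have key : (cond_entropy s (a &&& d) + cond_entropy s (a &&& c) <=
    cond_entropy s a + cond_entropy s (a &&& d &&& c))%E.
  rewrite /cond_entropy -!esum_muD; try by move=> w; exact: surprisal_ge0.
  apply: esum_mu_gibbs (gibbs d a c) _.
  - by move=> w mw; rewrite addr_ge0// surprisal_ge0.
  - by move=> w mw; rewrite addr_ge0// surprisal_ge0.
  - by move=> w _; rewrite !(mulr_ge0, invr_ge0)// pr_ge0.
  move=> w mw; have := dcas w mw; rewrite /surprisal.
  rewrite (@pf_eq _ _ (d &&& c &&& (a &&& s)) (s &&& (a &&& d &&& c)) _ _ _ mw); try solve_det.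
  rewrite (@pf_eq _ _ (a &&& s) (s &&& a) _ _ _ mw); try solve_det.
  rewrite (@pf_eq _ _ (d &&& (a &&& s)) (s &&& (a &&& d)) _ _ _ mw); try solve_det.
  rewrite (@pf_eq _ _ (c &&& (a &&& s)) (s &&& (a &&& c)) _ _ _ mw); try solve_det.
  rewrite (@pf_eq _ _ (d &&& a) (a &&& d) _ _ _ mw); try solve_det.
  rewrite (@pf_eq _ _ (d &&& a &&& c) (a &&& d &&& c) _ _ _ mw); try solve_det.
  move=> e; have := congr1 (@ln R) e.
  have := @ln_ratio (fiber_prob (a &&& d) w * fiber_prob (a &&& c) w)
    (fiber_prob (a &&& d &&& c) w * fiber_prob a w).
  rewrite !ln_div ?posrE ?pf_gt0// !lnM ?posrE ?mulr_gt0 ?pf_gt0// => /(_ isT isT).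
  lra.
have [x1 _ e1] := condH_fin a sfin; have [x2 _ e2] := condH_fin c sfin.
have [x3 _ e3] := condH_fin (a &&& c) sfin; have [x4 _ e4] := condH_fin (a &&& d) sfin.
have [x5 _ e5] := condH_fin (a &&& d &&& c) sfin.
have [x6 _ e6] := condH_fin (@const_rv W) sfin.
by move: h key; rewrite e1 e2 e3 e4 e5 e6 -!EFinD !lee_fin; lra.
Qed.

End Probability.

(** * Finite-valued variables: Fano's bound and the common information *)

Section Finite.
Variables (R : realType) (W : choiceType) (mu : W -> R).
Hypothesis mu_ge0 : forall w, 0 <= mu w.
Hypothesis mu_sum : (\esum_(w in setT) (mu w)%:E = 1)%E.
Local Notation pr := (prob mu).
Local Notation pf := (fiber_prob mu).
Local Notation condH := (cond_entropy mu).
Local Notation ent_rv f := (condH f (@const_rv W)).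

Let muE0 w : (0 <= (mu w)%:E)%E. Proof. by rewrite lee_fin. Qed.
Hint Resolve muE0 : core.

Lemma mu_surprisal_ge0 (S T : Type) (f : W -> S) (g : W -> T) w :
  (0 <= (mu w * surprisal mu f g w)%:E)%E.
Proof.
have [->|mw] := mu_or mu_ge0 w; first by rewrite mul0r.
by rewrite lee_fin mulr_ge0// surprisal_ge0.
Qed.

Lemma esum_surprisal_cell (S T : Type) (f : W -> S) (g : W -> T) s t :
  let p := pr [set w | f w = s /\ g w = t] in
  (\esum_(w in [set w | f w = s /\ g w = t]) (mu w * surprisal mu f g w)%:E =
   (p * ln (pr [set w | g w = t] / p))%:E)%E.
Proof.
move=> p; have [p0|p0] := eqVneq p 0.
  rewrite p0 mul0r; apply: esum1 => w [fw gw].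
  have [->|mw] := mu_or mu_ge0 w; first by rewrite mul0r.
  suff : 0 < p by rewrite p0 ltxx.
  exact: (pr_gt0 mu_ge0 mu_sum (w := w)).
have pgt0 : 0 < p by rewrite lt_neqAle eq_sym p0 pr_ge0.
have pp : p <= pr [set w | g w = t] by apply: pr_le => // w [].
transitivity (\esum_(w in [set w | f w = s /\ g w = t])
    ((ln (pr [set w | g w = t] / p))%:E * (mu w)%:E))%E.
  apply: eq_esum => w [fw gw]; rewrite /surprisal /fiber_prob gw -EFinM mulrC.
  congr (ln (_ / pr _) * _)%:E; apply/seteqP; rewrite /jnt fw gw; split => x /=.
    by case.
  by move=> [-> ->].
rewrite ge0_esumZl//; last by rewrite ln_ge0// ler_pdivlMr// mul1r.
by rewrite -prE// -EFinM mulrC.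
Qed.

Lemma ent_cell (T : Type) (f : W -> T) t :
  let p := pr [set w | f w = t] in
  (\esum_(w in [set w | f w = t]) (mu w * surprisal mu f (@const_rv W) w)%:E =
   (- (p * ln p))%:E)%E.
Proof.
move=> p; have /= := esum_surprisal_cell f (@const_rv W) t tt.
rewrite (_ : [set w | f w = t /\ const_rv w = tt] = [set w | f w = t]); last first.
  by apply/seteqP; split => w /= => [[]|].
rewrite (_ : [set w | const_rv w = tt] = setT); last by apply/seteqP; split.
rewrite prT// -/p => ->; rewrite div1r; have [->|p0] := eqVneq p 0.
  by rewrite !mul0r oppr0.
by rewrite lnV ?mulrN// posrE lt_neqAle eq_sym p0 pr_ge0.
Qed.

Lemma ent_esum (T : choiceType) (f : W -> T) (q : T -> R) :
  (forall t, q t = pr [set w | f w = t]) ->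
  ent_rv f = (\esum_(t in setT) (- (q t * ln (q t)))%:E)%E.
Proof.
move=> qE; rewrite /cond_entropy (esum_fiber _ f); last exact: mu_surprisal_ge0.
by apply: eq_esum => t _; rewrite setTI ent_cell qE.
Qed.

Lemma ent_seq (T : choiceType) (f : W -> T) (s : seq T) :
  uniq s -> (forall w, f w \in s) ->
  ent_rv f = (- \sum_(t <- s) pr [set w | f w = t] * ln (pr [set w | f w = t]))%:E.
Proof.
move=> us fs; rewrite /cond_entropy (esum_fiber_seq (s := s) (f := f))//; last first.
  exact: mu_surprisal_ge0.
rewrite -sumrN -sumEFin; apply: eq_bigr => t _.
by rewrite setTI ent_cell.
Qed.

Lemma ent_Hfin (T : finType) (f : W -> T) (q : T -> R) :
  (forall t, q t = pr [set w | f w = t]) -> ent_rv f = (Hfin q)%:E.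
Proof.
move=> qE; rewrite (ent_seq (s := index_enum T)) ?index_enum_uniq//; last first.
  by move=> w; rewrite mem_index_enum.
by congr (- _)%:E; apply: eq_bigr => t _; rewrite qE.
Qed.

Lemma ent_Hfun (U : finType) (f : W -> U) (q : U -> R) (F : U -> nat) :
  (forall u, q u = pr [set w | f w = u]) ->
  ent_rv (fun w => F (f w)) = (Hfun q F)%:E.
Proof.
move=> qE; rewrite (ent_seq (s := undup [seq F u | u <- enum U])) ?undup_uniq//.
  rewrite /Hfun; congr (- _)%:E.
  apply: eq_bigr => n _.
  suff -> : pr [set w | F (f w) = n] = \sum_(u | F u == n) q u by [].
  rewrite (pr_fiber mu_ge0 mu_sum f) [RHS]big_mkcond; apply: eq_bigr => u _; case: eqP => Fu.
    rewrite qE; congr pr; apply/seteqP; split => [w [] //|w /= fw].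
    by split => //; rewrite fw.
  rewrite (_ : _ `&` _ = set0) ?/prob ?esum_set0//.
  by apply/seteqP; split => // w [/= + fw]; rewrite fw.
by move=> w; rewrite mem_undup; apply: map_f; rewrite mem_enum.
Qed.

Lemma ent_fin_num (T : finType) (f : W -> T) : ent_rv f \is a fin_num.
Proof. by rewrite (@ent_Hfin _ f (fun t => pr [set w | f w = t])). Qed.

(* Any bound vanishing with the error probability would do. *)
Lemma fano (T : finType) (f g : W -> T) :
  (condH f g <= (2 * (#|T| ^ 2)%:R * Num.sqrt (pr [set w | f w <> g w]))%:E)%E.
Proof.
set d := pr _; have d0 : 0 <= d by exact: pr_ge0.
have dsqrt : d <= Num.sqrt d.
  rewrite -{1}(sqr_sqrtr d0) expr2 ler_piMl ?sqrtr_ge0//.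
  by rewrite -sqrtr1 ler_wsqrtr// pr_le1.
rewrite /cond_entropy (esum_fiber_fin _ (f &&& g)); last exact: mu_surprisal_ge0.
(* Each pair of values (t, t') contributes at most 2 sqrt d, whence the factor [#|T| ^ 2]. *)
apply: (@le_trans _ _ (\sum_(t : T * T) (2 * Num.sqrt d)%:E)%E).
  apply: lee_sum => -[t t'] _; rewrite setTI.
  rewrite (_ : [set w | _] = [set w | f w = t /\ g w = t']); last first.
    by apply/seteqP; rewrite /jnt; split => w /= => [[-> ->]|[-> ->]].
  rewrite esum_surprisal_cell lee_fin.
  set p := pr _; have [->|pn0] := eqVneq p 0.
    by rewrite mul0r mulr_ge0// sqrtr_ge0.
  have p0 : 0 < p by rewrite lt_neqAle eq_sym pn0 pr_ge0.
  have pP : p <= pr [set w | g w = t'] by apply: pr_le => // w [].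
  have P0 := lt_le_trans p0 pP.
  have [tt'|tt'] := eqVneq t t'.
    (* On the diagonal, p ln(P / p) <= P - p <= d <= sqrt d, where P is the mass of g = t'. *)
    have PE : pr [set w | g w = t'] <= p + d.
      rewrite (prID mu_ge0 mu_sum _ [set w | f w = g w]); apply: lerD.
        by apply: pr_le => // w [/= -> ->].
      by apply: pr_le => // w [].
    have := ln_ratio P0 p0; rewrite ln_div ?posrE// => h.
    have : p * (ln (pr [set w | g w = t']) - ln p + 1) <= pr [set w | g w = t'].
      by apply: le_trans (ler_wpM2l (ltW p0) h) _; rewrite mulrC divfK.
    have := sqrtr_ge0 d; lra.
  (* Off the diagonal, -p ln p = -2 p ln(sqrt p) <= 2 sqrt p, and p <= d. *)
  have pd : p <= d by apply: pr_le => // w [/= -> ->]; exact/eqP.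
  have s0 : 0 < Num.sqrt p by rewrite sqrtr_gt0.
  have sE : Num.sqrt p * Num.sqrt p = p by rewrite -expr2 sqr_sqrtr// ltW.
  apply: (@le_trans _ _ (2 * Num.sqrt p)); last first.
    by rewrite ler_pM2l// ler_wsqrtr.
  have lnP : ln (pr [set w | g w = t']) <= 0 by apply: ln_le0; exact: pr_le1.
  have lnp : ln p = 2 * ln (Num.sqrt p) by rewrite -{1}sE lnM ?posrE//; ring.
  have := @ln_ratio _ 1 (Num.sqrt p) ltr01 s0; rewrite ln1 => h.
  have h2 : Num.sqrt p * (0 - ln (Num.sqrt p) + 1) <= 1.
    by apply: le_trans (ler_wpM2l (ltW s0) h) _; rewrite mulrC divfK// gt_eqF.
  rewrite ln_div ?posrE// lnp -{1}sE.
  have := ler_wpM2l (ltW s0) h2.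
  have := ler_wpM2l (ltW p0) lnP; rewrite -{1 2}sE.
  nra.
rewrite sumEFin lee_fin sumr_const card_prod -mulnn.
by rewrite -[leLHS]mulr_natr mulrAC.
Qed.

(** The factorisation at all values, null ones included: in this form it can be summed over the
    values of a variable, as [cind_pt_map] does. *)
Definition cind_pt (S T U : Type) (f : W -> S) (g : W -> T) (k : W -> U) : Prop :=
  forall s t u,
    pr [set w | [/\ f w = s, g w = t & k w = u]] * pr [set w | k w = u] =
    pr [set w | f w = s /\ k w = u] * pr [set w | g w = t /\ k w = u].

Lemma cind_ptW (S T U : Type) (f : W -> S) (g : W -> T) (k : W -> U) :
  cind_pt f g k -> cind mu f g k.
Proof.
move=> h w mw; have := h (f w) (g w) (k w); rewrite /fiber_prob /jnt.
rewrite (_ : [set w' | (f w', g w', k w') = _] =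
  [set w' | [/\ f w' = f w, g w' = g w & k w' = k w]]); last first.
  by apply/seteqP; split => x /= [-> -> ->].
rewrite (_ : [set w' | (f w', k w') = _] = [set w' | f w' = f w /\ k w' = k w]); last first.
  by apply/seteqP; split => x /= [-> ->].
rewrite (_ : [set w' | (g w', k w') = _] = [set w' | g w' = g w /\ k w' = k w])//.
by apply/seteqP; split => x /= [-> ->].
Qed.


(** By the two Markov chains both sides equal P(k = c | f = u, g = v). *)
Lemma cind_pt_cond (U V : finType) (T : Type) (f : W -> U) (g : W -> V) (k : W -> T) u v c :
  cind_pt k g f -> cind_pt k f g -> 0 < pr [set w | f w = u /\ g w = v] ->
  pr [set w | k w = c /\ f w = u] / pr [set w | f w = u] =
  pr [set w | k w = c /\ g w = v] / pr [set w | g w = v].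
Proof.
move=> kgf kfg uv; have := kgf c v u; have := kfg c u v.
rewrite (_ : [set w | [/\ k w = c, f w = u & g w = v]] =
   [set w | [/\ k w = c, g w = v & f w = u]]); last first.
  by apply/seteqP; split => w [].
rewrite (_ : [set w | g w = v /\ f w = u] = [set w | f w = u /\ g w = v]); last first.
  by apply/seteqP; split => w [].
move: uv; set puv := pr [set w | f w = u /\ g w = v] => uv.
have pu : 0 < pr [set w | f w = u] by apply: lt_le_trans uv _; apply: pr_le => // w [].
have pv : 0 < pr [set w | g w = v] by apply: lt_le_trans uv _; apply: pr_le => // w [].
move: (pr [set w | [/\ _, _ & _]]) => x e1 e2.
apply/eqP; rewrite eqr_div ?(gt_eqF pu) ?(gt_eqF pv)//; apply/eqP.
apply: (mulIf (x := puv)); first by rewrite gt_eqF.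
rewrite mulrAC -e2 [RHS]mulrAC -e1; ring.
Qed.

(* If K - U - V and K - V - U are both Markov chains, the conditional law of K
   given U is a common function of U and V; it carries all of I(U;K), which is
   thus at most the Gacs-Korner information. *)
Lemma RI_bound (U V : finType) (T : Type) (f : W -> U) (g : W -> V) (k : W -> T)
  (q : U * V -> R) :
  (forall u v, q (u, v) = pr [set w | f w = u /\ g w = v]) ->
  cind_pt k g f -> cind_pt k f g ->
  ((RI q)%:E + condH f g <= condH f k)%E /\ ((RI q)%:E + condH g f <= condH g k)%E.
Proof.
move=> qE kgf kfg.
pose kappa u c := pr [set w | k w = c /\ f w = u] / pr [set w | f w = u].
(* The label of [u] is the position of the first value with the same conditional law: equal labels
   mean equal laws, and labels are natural numbers as [GK] requires. *)
pose phi u := find (fun u' => `[< kappa u' = kappa u >]) (enum U).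
have phiP u u' : phi u = phi u' <-> kappa u = kappa u'.
  split => [e|e]; last by rewrite /phi e.
  have hs x : has (fun u' => `[< kappa u' = kappa x >]) (enum U).
    by apply/hasP; exists x; rewrite ?mem_enum//; apply/asboolP.
  have /asboolP <- := nth_find u (hs u).
  by have /asboolP <- := nth_find u (hs u'); rewrite -/(phi u) -/(phi u') e.
(* The label is read off any [u] compatible with [v]; the value 0 is taken only where [v] has no
   compatible [u]. *)
pose gam v := if [pick u | 0 < q (u, v)] is Some u then phi u else 0%N.
have phigam u v : 0 < q (u, v) -> phi u = gam v.
  move=> quv; rewrite /gam; case: pickP => [u' qu'v|/(_ u)]; last by rewrite quv.
  apply/phiP/funext => c; rewrite /kappa (cind_pt_cond c kgf kfg (v := v)) -?qE//.
  by rewrite (cind_pt_cond c kgf kfg (v := v)) -?qE.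
have phigamw w : 0 < mu w -> phi (f w) = gam (g w).
  by move=> mw; apply: phigam; rewrite qE; apply: (pr_gt0 mu_ge0 mu_sum (w := w)).
pose om w := phi (f w).
have kf w : 0 < mu w -> pf (f &&& k) w = kappa (f w) (k w) * pf f w.
  move=> mw; rewrite /kappa divfK ?gt_eqF ?(pf_gt0 mu_ge0 mu_sum f)//.
  by congr pr; apply/seteqP; rewrite /jnt; split => x /= [-> ->].
have kg w : 0 < mu w -> pf (g &&& k) w = kappa (f w) (k w) * pf g w.
  move=> mw; rewrite /kappa (cind_pt_cond _ kgf kfg (v := g w)); last first.
    by apply: (pr_gt0 mu_ge0 mu_sum (w := w)).
  rewrite divfK ?gt_eqF ?(pf_gt0 mu_ge0 mu_sum g)//.
  by congr pr; apply/seteqP; rewrite /jnt; split => x /= [-> ->].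
(* The values [u] sharing a label share the law [kappa u], so this is also the law of [k] given the
   label. *)
have kom w : 0 < mu w -> pf (k &&& om) w = kappa (f w) (k w) * pf om w.
  move=> mw; rewrite /fiber_prob !(pr_fiber mu_ge0 mu_sum f) mulr_sumr.
  apply: eq_bigr => u _; have [e|ne] := pselect (om w = phi u); last first.
    rewrite (_ : _ `&` _ = set0); last first.
      by apply/seteqP; split => // x [/= + fx]; rewrite /jnt /om fx => -[_ /esym].
    rewrite (_ : [set _ | om _ = _] `&` _ = set0); last first.
      by apply/seteqP; split => // x [/= + fx]; rewrite /om fx => /esym.
    by rewrite /prob esum_set0 mulr0.
  rewrite (_ : _ `&` _ = [set w' | k w' = k w /\ f w' = u]); last first.
    apply/seteqP; rewrite /jnt; split => x /=; first by move=> [[-> _] ->].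
    by move=> [-> fx]; split => //; rewrite e /om fx.
  rewrite (_ : [set _ | om _ = _] `&` _ = [set w' | f w' = u]); last first.
    apply/seteqP; split => x /=; first by case.
    by move=> fx; split => //; rewrite e /om fx.
  have [z|z] := eqVneq (pr [set w' | f w' = u]) 0.
    rewrite z mulr0; apply/eqP; rewrite eq_le pr_ge0// andbT -z; apply: pr_le => // x [].
    done.
  by have /phiP -> := e; rewrite /kappa divfK.
have cf : cind mu f k om.
  move=> w mw; rewrite kom// mulrA.
  rewrite (@pf_eq _ _ _ mu_ge0 mu_sum _ _ (f &&& k &&& om) (f &&& k))//; last 2 first.
  - solve_det.
  - by move=> x y _ _; rewrite /jnt /om => -[-> ->].
  rewrite (@pf_eq _ _ _ mu_ge0 mu_sum _ _ (f &&& om) f)//; last 2 first.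
  - solve_det.
  - by move=> x y _ _; rewrite /jnt /om => ->.
  by rewrite kf// [_ * pf f w]mulrC.
have cg : cind mu g k om.
  move=> w mw; rewrite kom// mulrA.
  rewrite (@pf_eq _ _ _ mu_ge0 mu_sum _ _ (g &&& k &&& om) (g &&& k))//; last 2 first.
  - solve_det.
  - by move=> x y mx my; rewrite /jnt /om !phigamw// => -[-> ->].
  rewrite (@pf_eq _ _ _ mu_ge0 mu_sum _ _ (g &&& om) g)//; last 2 first.
  - solve_det.
  - by move=> x y mx my; rewrite /jnt /om !phigamw// => ->.
  by rewrite kg// [_ * pf g w]mulrC.
have mL u : margL q u = pr [set w | f w = u].
  rewrite (pr_fiber mu_ge0 mu_sum g); apply: eq_bigr => v _; rewrite qE.
  by congr pr; apply/seteqP; split.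
have mR v : margR q v = pr [set w | g w = v].
  rewrite (pr_fiber mu_ge0 mu_sum f); apply: eq_bigr => u _; rewrite qE.
  by congr pr; apply/seteqP; split => x [].
have HF := ent_Hfin mL; have HG := ent_Hfin mR.
have HFG : ent_rv (f &&& g) = (Hfin q)%:E.
  apply: ent_Hfin => -[u v]; rewrite qE.
  by congr pr; apply/seteqP; rewrite /jnt; split => x /= [-> ->].
have HO := @ent_Hfun _ f _ phi mL.
have gk : Hfun (margL q) phi <= GK q.
  (* The supremum in [GK] is taken over a set bounded by H(U), because a function of U has at most
     the entropy of U. *)
  apply: sup_upper_bound; last by exists phi, gam.
  split; first by exists (Hfun (margL q) phi), phi, gam.
  exists (Hfin (margL q)) => _ [F [G [_ ->]]].
  rewrite -lee_fin -HF -(@ent_Hfun _ f _ F mL).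
  by apply: condH_le => // x y _ _; rewrite /jnt => -[->].
have fin_f := ent_fin_num f; have fin_g := ent_fin_num g.
(* I(f;k) <= H(om), since [f] and [k] are independent given [om]. *)
have Hf : (ent_rv f <= condH f k + ent_rv om)%E.
  rewrite (@condH_eq _ _ _ mu_ge0 mu_sum _ _ _ _ f (@const_rv W) (f &&& om) (@const_rv W));
    try solve_det; last by move=> x y _ _; rewrite /jnt /om => -[->].
  rewrite condH_chain//; apply: leeD => //.
  rewrite (@condH_eq _ _ _ mu_ge0 mu_sum _ _ _ _ f (om &&& @const_rv W) f om);
    try solve_det.
  by rewrite -(condH_cind mu_ge0 mu_sum cf); apply: condH_le => //; solve_det.
have Hg : (ent_rv g <= condH g k + ent_rv om)%E.
  rewrite (@condH_eq _ _ _ mu_ge0 mu_sum _ _ _ _ g (@const_rv W) (g &&& om) (@const_rv W));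
    try solve_det; last by move=> x y mx my; rewrite /jnt /om !phigamw// => -[->].
  rewrite condH_chain//; apply: leeD => //.
  rewrite (@condH_eq _ _ _ mu_ge0 mu_sum _ _ _ _ g (om &&& @const_rv W) g om);
    try solve_det.
  by rewrite -(condH_cind mu_ge0 mu_sum cg); apply: condH_le => //; solve_det.
have chfg : (ent_rv (f &&& g) = condH f g + ent_rv g)%E.
  rewrite condH_chain//; congr (_ + _)%E; apply: condH_eq => //; solve_det.
have chgf : (ent_rv (f &&& g) = condH g f + ent_rv f)%E.
  rewrite (@condH_eq _ _ _ mu_ge0 mu_sum _ _ _ _ (f &&& g) (@const_rv W) (g &&& f) (@const_rv W));
    try solve_det.
  rewrite condH_chain//; congr (_ + _)%E; apply: condH_eq => //; solve_det.
have [x1 _ e1] := condH_fin mu_ge0 mu_sum k fin_f.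
have [x2 _ e2] := condH_fin mu_ge0 mu_sum k fin_g.
have [x3 _ e3] := condH_fin mu_ge0 mu_sum g fin_f.
have [x4 _ e4] := condH_fin mu_ge0 mu_sum f fin_g.
move: Hf Hg chfg chgf; rewrite e1 e2 e3 e4 HF HG HFG HO -!EFinD !lee_fin => Hf Hg [c1] [c2].
rewrite /RI /MI; split; lra.
Qed.

End Finite.

Opaque cond_entropy.

Lemma esum_prod_pmf (R : realType) (S T : choiceType) (a : S -> R) (b : T -> R) :
  (forall s, 0 <= a s) -> (forall t, 0 <= b t) ->
  (\esum_(s in setT) (a s)%:E = 1)%E -> (\esum_(t in setT) (b t)%:E = 1)%E ->
  (\esum_(k in [set: S * T]) (a k.1 * b k.2)%:E = 1)%E.
Proof.
move=> a0 b0 a1 b1.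
rewrite (_ : setT = setT `*`` (fun _ : S => [set: T])); last by apply/seteqP; split.
rewrite -(@esum_esum _ _ _ setT (fun=> setT) (fun s t => (a s * b t)%:E)); last first.
  by move=> s t _ _; rewrite lee_fin mulr_ge0.
rewrite -a1; apply: eq_esum => s _.
under eq_esum do rewrite EFinM.
by rewrite ge0_esumZl// ?b1 ?mule1// => t; rewrite lee_fin.
Qed.

Lemma esum_seq_cons (R : realType) (T : choiceType) (a : seq T -> \bar R) :
  (forall s, (0 <= a s)%E) ->
  (\esum_(s in setT) a s = a [::] + \esum_(x in setT) \esum_(s in setT) a (x :: s))%E.
Proof.
move=> a0; rewrite (esumID [set [::]])// setTI esum_set1//; congr (_ + _)%E.
rewrite setTI esum_esum//.
apply: (reindex_esum _ _ (fun k : T * seq T => k.1 :: k.2)); split => //=.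
- by move=> [x s] [y t] _ _ /= [-> ->].
- by move=> [|x s] //= _; exists (x, s).
Qed.

(** * The law of the padded history *)

Section Law.
Variables (R : realType) (X Y Z : finType) (P : protocol R X Y Z).
Hypothesis kA : kernel_ok (kerA P).
Hypothesis kB : kernel_ok (kerB P).
Hypothesis kC : kernel_ok (kerC P).
Local Notation history := (history X Y Z).
Local Notation round := (round X Y Z).

Definition idle_round : round := (Idle, Idle, Idle).

Lemma idle_pmf (O : choiceType) :
  (\esum_(m in [set: move O]) ((if is_idle m then 1 else 0) : R)%:E = 1)%E.
Proof.
rewrite (esumID [set Idle])//; last by move=> m _; case: ifP.
rewrite setTI esum_set1// esum1 ?adde0// => -[m|[]] //= [_]; by case.
Qed.

Lemma step_pmf (O : choiceType) (V : Type) (k : V -> move O -> R) (b : bool) v :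
  kernel_ok k ->
  (forall m, 0 <= (if b then (if is_idle m then 1 else 0) else k v m)) /\
  (\esum_(m in setT) (if b then (if is_idle m then 1 else 0) else k v m)%:E = 1)%E.
Proof.
move=> /(_ v)[k0 [_ k1]]; case: b; split => //; last exact: idle_pmf.
by move=> m; case: ifP.
Qed.

Lemma rstep_ge0 h r : 0 <= rstep P h r.
Proof.
have [a0 _] := step_pmf (haltedA h) (viewA h) kA.
have [b0 _] := step_pmf (haltedB h) (viewB h) kB.
have [c0 _] := step_pmf (haltedC h) (viewC h) kC.
by rewrite /rstep mulr_ge0 ?mulr_ge0 ?a0 ?b0 ?c0.
Qed.

Lemma rstep_sum h : (\esum_(r in setT) (rstep P h r)%:E = 1)%E.
Proof.
have [a0 a1] := step_pmf (haltedA h) (viewA h) kA.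
have [b0 b1] := step_pmf (haltedB h) (viewB h) kB.
have [c0 c1] := step_pmf (haltedC h) (viewC h) kC.
apply: (@esum_prod_pmf R _ _ (fun r => stepA P h r.1 * stepB P h r.2) (stepC P h)) => //.
  by move=> r; rewrite mulr_ge0 ?a0 ?b0.
exact: (@esum_prod_pmf R _ _ (stepA P h) (stepB P h)).
Qed.

Lemma hprob_nil : hprob P [::] = 1.
Proof. by rewrite /hprob big_ord0. Qed.

Lemma hprob_rcons h r : hprob P (rcons h r) = hprob P h * rstep P h r.
Proof.
rewrite /hprob size_rcons big_ord_recr/=; congr (_ * _).
  apply: eq_bigr => i _; rewrite -cats1 takel_cat; last exact: ltnW.
  by rewrite nth_cat ltn_ord.
by rewrite -cats1 take_size_cat// nth_cat ltnn subnn.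
Qed.

Lemma hprob_ge0 h : 0 <= hprob P h.
Proof. by apply: prodr_ge0 => i _; exact: rstep_ge0. Qed.

(** For [h] empty: [hprob] is a probability on the histories of each fixed length. *)
Lemma esum_hprob_cat n (h : history) :
  (\esum_(e in setT) (if size e == n then (hprob P (h ++ e))%:E else 0) = (hprob P h)%:E)%E.
Proof.
elim: n h => [|n IH] h.
  rewrite (esumID [set [::]]) ?setTI ?esum_set1/= ?cats0 ?lee_fin ?hprob_ge0//.
    by rewrite esum1 ?adde0// => e /= e0; rewrite size_eq0; case: eqP.
  by move=> e _; case: ifP => // _; rewrite lee_fin hprob_ge0.
rewrite esum_seq_cons; last first.
  by move=> e; case: ifP => // _; rewrite lee_fin hprob_ge0.
rewrite add0e; transitivity (\esum_(r in setT) (hprob P h)%:E * (rstep P h r)%:E)%E.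
  apply: eq_esum => r _; rewrite -EFinM -hprob_rcons -IH.
  by apply: eq_esum => e _; rewrite eqSS cat_rcons.
by rewrite ge0_esumZl ?hprob_ge0 ?rstep_sum ?mule1// => r; rewrite lee_fin rstep_ge0.
Qed.

Lemma all_halted_cat (h e : history) : all_halted h -> all_halted (h ++ e).
Proof.
rewrite /all_halted /haltedA /haltedB /haltedC !has_cat.
by move=> /and3P[-> -> ->].
Qed.

Lemma terminal_cat_cons (h e : history) r : all_halted h -> ~~ terminal (h ++ r :: e).
Proof.
move=> hh; rewrite /terminal negb_and negbK; apply/orP; right.
rewrite size_cat /= addnS /= take_cat ltnNge leq_addr /= addKn.
exact: all_halted_cat.
Qed.

Lemma terminal_halted (h : history) : terminal h -> all_halted h.
Proof. by case/andP. Qed.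

(** [hprob] has mass 1 at every length. Terminal histories, none of which properly extends another,
    leave one sample point for each finished run. *)
Definition hist_pmf (h : history) : R := if terminal h then hprob P h else 0.

Lemma hist_pmf_ge0 h : 0 <= hist_pmf h.
Proof. by rewrite /hist_pmf; case: ifP => // _; exact: hprob_ge0. Qed.

(** A Kraft inequality, as the terminal extensions of [h] are prefix-free. Induction handles
    extensions of bounded length, and the full sum is a supremum over finite sets. *)
Lemma esum_mu_cat (h : history) : (\esum_(e in setT) (hist_pmf (h ++ e))%:E <= (hprob P h)%:E)%E.
Proof.
have bound n (g : history) :
    (\esum_(e in setT) (if (size e <= n)%N then (hist_pmf (g ++ e))%:E else 0)
     <= (hprob P g)%:E)%E.
  elim: n g => [|n IH] g.
    rewrite (esumID [set [::]]) ?setTI ?esum_set1/= ?cats0 ?lee_fin ?hist_pmf_ge0//; last first.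
      by move=> e _; case: ifP => // _; rewrite lee_fin hist_pmf_ge0.
    rewrite esum1 ?adde0; last by move=> e /= e0; rewrite leqn0 size_eq0; case: eqP.
    by rewrite lee_fin /hist_pmf; case: ifP => // _; exact: hprob_ge0.
  rewrite esum_seq_cons; last first.
    by move=> e; case: ifP => // _; rewrite lee_fin hist_pmf_ge0.
  rewrite /= cats0; have [hg|hg] := boolP (all_halted g).
    rewrite [X in (_ + X)%E]esum1 ?adde0; last first.
      move=> r _; apply: esum1 => e _; rewrite /hist_pmf (negbTE (terminal_cat_cons _ _ _))//.
      by rewrite if_same.
    by rewrite lee_fin /hist_pmf; case: ifP => // _; exact: hprob_ge0.
  rewrite {1}/hist_pmf /terminal (negbTE hg) /= add0e.
  apply: (@le_trans _ _ (\esum_(r in setT) (hprob P g)%:E * (rstep P g r)%:E)%E).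
    apply: le_esum => r _; rewrite -EFinM -hprob_rcons; apply: le_trans (IH _).
    by apply: le_esum => e _; rewrite ltnS cat_rcons.
  by rewrite ge0_esumZl ?hprob_ge0 ?rstep_sum ?mule1// => r; rewrite lee_fin rstep_ge0.
apply: ge_ereal_sup => /= _ [F [finF _] <-].
have [n Fn] : exists n, forall e, F e -> (size e <= n)%N.
  have /finite_seqP[s ->] := finF; exists (\max_(e <- s) size e)%N => e /= es.
  exact: leq_bigmax_seq.
apply: le_trans (bound n h); apply: esum_ge; exists F => //.
by apply: lee_fsum => // e /Fn ->.
Qed.

(* Terminal histories have various lengths; continuing them with idle rounds
   turns the protocol into a process indexed by all rounds, and [pad n] is its
   state after [n] rounds. *)
Definition pad n (h : history) : history := mkseq (nth idle_round h) n.

Lemma size_pad n h : size (pad n h) = n.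
Proof. exact: size_mkseq. Qed.

Lemma padS n h : pad n.+1 h = rcons (pad n h) (nth idle_round h n).
Proof. by rewrite /pad mkseqS. Qed.

Lemma pad_take n h : (n <= size h)%N -> pad n h = take n h.
Proof.
move=> nh; apply: (@eq_from_nth _ idle_round).
  by rewrite size_pad size_take; case: ltngtP nh.
by move=> i; rewrite size_pad => ni; rewrite nth_mkseq// nth_take.
Qed.

Lemma pad_cat n h : (size h <= n)%N -> pad n h = h ++ nseq (n - size h) idle_round.
Proof.
move=> nh; apply: (@eq_from_nth _ idle_round).
  by rewrite size_pad size_cat size_nseq subnKC.
move=> i; rewrite size_pad => ni; rewrite nth_mkseq// nth_cat.
by case: ltnP => // hi; rewrite nth_default// nth_nseq if_same.
Qed.

Lemma hprob_idle h n : all_halted h -> hprob P (h ++ nseq n idle_round) = hprob P h.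
Proof.
move=> hh; elim: n => [|n IH]; first by rewrite cats0.
rewrite -addn1 nseqD catA cats1 hprob_rcons IH.
have /and3P[a b c] := all_halted_cat (nseq n idle_round) hh.
by rewrite /rstep /stepA /stepB /stepC a b c /= !mulr1.
Qed.

(** A terminal history stops at the first round when all have halted, so whether the run has ended
    by round n can be read off its padded version. *)
Lemma terminal_pad n h : terminal h -> all_halted (pad n h) = (size h <= n)%N.
Proof.
move=> th; case: (leqP (size h) n) => hn.
  by rewrite pad_cat// all_halted_cat// terminal_halted.
rewrite pad_take; last exact: ltnW.
apply/negP => hh; move/andP: th => [_ /negP]; apply.
rewrite (_ : take _ h = take n h ++ drop n (take (size h).-1 h)); last first.
  by rewrite -{1}(cat_take_drop n (take _ h)) take_takel//; case: (size h) hn.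
exact: all_halted_cat.
Qed.

(** If all have halted in [h0], at most one terminal history pads to it, and the added idle rounds
    have probability 1. Otherwise the terminal histories padding to [h0] are extensions of it. *)
Lemma pad_law_le n h0 : size h0 = n ->
  (\esum_(h in [set h | pad n h = h0]) (hist_pmf h)%:E <= (hprob P h0)%:E)%E.
Proof.
move=> sz; have [hh|hh] := boolP (all_halted h0).
  have uniq h h' : terminal h -> terminal h' -> pad n h = h0 -> pad n h' = h0 -> h = h'.
    have len g : terminal g -> pad n g = h0 -> (size g <= n)%N.
      by move=> tg e; rewrite -(terminal_pad n tg) e.
    have mono g g' : terminal g -> terminal g' -> pad n g = h0 -> pad n g' = h0 ->
        (size g' <= size g)%N.
      move=> tg tg' e e'; rewrite -(terminal_pad _ tg').
      have gn := len _ tg e; have gn' := len _ tg' e'.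
      have -> : pad (size g) g' = take (size g) h0.
        by rewrite -e' /pad -map_take take_iota; congr mkseq; rewrite (minn_idPl gn).
      by rewrite -e pad_cat// take_size_cat// terminal_halted.
    move=> th th' e e'; have sE : size h = size h' by apply/eqP; rewrite eqn_leq !mono.
    move: (e); rewrite -e' !pad_cat ?len// sE => /eqP.
    by rewrite eqseq_cat// => /andP[/eqP].
  have [[h [th ph]]|nex] := pselect (exists h, terminal h /\ pad n h = h0).
    rewrite esum_mkcond; apply: (@le_trans _ _ (\esum_(g in [set h]) (hist_pmf g)%:E)%E).
      rewrite [leRHS]esum_mkcond; apply: le_esum => g _.
      case: ifPn => [|_]; last by case: ifP => // _; rewrite lee_fin hist_pmf_ge0.
      rewrite inE /= => pg; case: ifPn => // gh; rewrite /hist_pmf; case: ifP => // tg.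
      by move/negP: gh; case; rewrite inE /=; apply: uniq.
    rewrite esum_set1 ?lee_fin ?hist_pmf_ge0// /hist_pmf th -ph pad_cat ?hprob_idle//.
      exact: terminal_halted.
    by rewrite -(terminal_pad n th) ph.
  rewrite esum1 ?lee_fin ?hprob_ge0// => h ph; rewrite /hist_pmf; case: ifP => // th.
  by exfalso; apply: nex; exists h.
apply: le_trans (esum_mu_cat h0).
rewrite -(@esum_image _ _ _ setT (fun e => h0 ++ e) (fun h => (hist_pmf h)%:E)); last first.
  by move=> e e' _ _ /eqP; rewrite eqseq_cat// => /andP[_ /eqP].
rewrite [leLHS]esum_mkcond [leRHS]esum_mkcond; apply: le_esum => h _.
case: ifPn => [|_]; last by case: ifP => // _; rewrite lee_fin hist_pmf_ge0.
rewrite inE /= => ph; case: ifPn => // gh; rewrite /hist_pmf; case: ifP => // th.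
exfalso; move/negP: gh; apply; rewrite inE; exists (drop n h) => //.
rewrite -ph pad_take ?cat_take_drop//.
by rewrite leqNgt; apply: contra hh => hn; rewrite -ph terminal_pad// ltnW.
Qed.

Hypothesis term : terminates P.

Lemma hist_pmf_sum : (\esum_(h in setT) (hist_pmf h)%:E = 1)%E.
Proof.
rewrite -term /Pr setIT [RHS]esum_mkcond; apply: eq_esum => h _.
rewrite /hist_pmf; case: (boolP (terminal h)) => th; first by rewrite mem_set.
by rewrite memNset//; exact/negP.
Qed.

Lemma PrE E : Pr P E = (prob hist_pmf E)%:E.
Proof.
rewrite prE; [|exact: hist_pmf_ge0|exact: hist_pmf_sum].
rewrite /Pr [LHS]esum_mkcondl; apply: eq_esum => h _.
rewrite /hist_pmf; case: (boolP (terminal h)) => th; first by rewrite mem_set.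
by rewrite memNset//; exact/negP.
Qed.

(* Both sides are probability mass functions on the histories of length [n],
   so the inequality of [pad_law_le] is an equality; this is where termination
   with probability 1 is used. *)
Lemma pad_law n h0 : size h0 = n -> prob hist_pmf [set h | pad n h = h0] = hprob P h0.
Proof.
have mu0 h : (0 <= (hist_pmf h)%:E)%E by rewrite lee_fin hist_pmf_ge0.
pose L h0 := prob hist_pmf [set h | pad n h = h0].
have LE h : (L h)%:E = (\esum_(g in [set g | pad n g = h]) (hist_pmf g)%:E)%E.
  by rewrite prE; [|exact: hist_pmf_ge0|exact: hist_pmf_sum].
have Lle h : size h = n -> L h <= hprob P h.
  by move=> hn; rewrite -lee_fin LE pad_law_le.
have L0 h : 0 <= L h by apply: pr_ge0; [exact: hist_pmf_ge0|exact: hist_pmf_sum].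
have sumL : (\esum_(h in [set h | size h = n]) (L h)%:E = 1)%E.
  rewrite -hist_pmf_sum [RHS](esum_fiber _ (pad n))// [LHS]esum_mkcond.
  apply: eq_esum => h _; rewrite setTI -LE; case: ifPn => // hn.
  rewrite /L (_ : [set _ | _] = set0) ?/prob ?esum_set0//.
  apply/seteqP; split => // g /= gh; move/negP: hn; apply; rewrite inE /= -gh.
  exact: size_pad.
have sumH : (\esum_(h in [set h | size h = n]) (hprob P h)%:E = 1)%E.
  have -> : 1%E = (hprob P [::])%:E :> \bar R by rewrite hprob_nil.
  rewrite -(esum_hprob_cat n) esum_mkcond; apply: eq_esum => h _ /=.
  by case: eqP => hn; [rewrite mem_set | rewrite memNset].
have : (\esum_(h in [set h | size h = n]) (hprob P h - L h)%:E = 0)%E.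
  have : (\esum_(h in [set h | size h = n]) ((L h)%:E + (hprob P h - L h)%:E) = 1)%E.
    by rewrite -sumH; apply: eq_esum => h _; rewrite -EFinD addrC subrK.
  rewrite esumD; last 2 first.
  - by move=> h _; rewrite lee_fin.
  - by move=> h hn; rewrite lee_fin subr_ge0 Lle.
  rewrite sumL; case: (esum _ _) => [x| |]//.
  by rewrite -EFinD => -[] /eqP; rewrite -subr_eq0 addrAC subrr add0r => /eqP ->.
move=> d0 hn; apply/eqP; rewrite eq_le Lle//= -subr_le0 -lee_fin -[leRHS]/(0%E) -d0.
rewrite -(@esum_set1 _ _ h0 (fun h => (hprob P h - L h)%:E)) ?lee_fin ?subr_ge0 ?Lle//.
rewrite [leLHS]esum_mkcond [leRHS]esum_mkcond; apply: le_esum => h _.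
case: ifPn => [|_]; first by rewrite inE /= => ->; rewrite mem_set.
by case: ifPn => //; rewrite inE /= => sh; rewrite lee_fin subr_ge0 Lle.
Qed.

Lemma pad_lawE n (G : set history) : (prob hist_pmf [set h | G (pad n h)])%:E =
  (\esum_(h in [set h | size h = n /\ G h]) (hprob P h)%:E)%E.
Proof.
have mu0 h : (0 <= (hist_pmf h)%:E)%E by rewrite lee_fin hist_pmf_ge0.
rewrite prE; [|exact: hist_pmf_ge0|exact: hist_pmf_sum].
rewrite (esum_fiber _ (pad n))// [RHS]esum_mkcond; apply: eq_esum => h _.
case: ifPn => hG.
  move: hG; rewrite inE /= => -[hn Gh].
  rewrite -(pad_law hn) prE; [|exact: hist_pmf_ge0|exact: hist_pmf_sum].
  by congr esum; apply/seteqP; split => g /=; [case|move=> ->].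
apply: esum1 => g [/= Gg gh]; move/negP: hG; case; rewrite inE /= -gh; split => //.
exact: size_pad.
Qed.

End Law.

Section Mix.
Variables (X Y Z : finType).
Local Notation history := (history X Y Z).
Local Notation round := (round X Y Z).

(** * Exchanging the moves of some parties *)

(* A mask over (Alice, Bob, Charlie): in [mix b h h'] the parties marked [true]
   move as in [h'] and the others as in [h]. *)
Definition sides := (bool * bool * bool)%type.

Definition mix_round (b : sides) (r r' : round) : round :=
  (if b.1.1 then mA r' else mA r, if b.1.2 then mB r' else mB r,
   if b.2 then mC r' else mC r).

Definition mix (b : sides) (h h' : history) : history :=
  [seq mix_round b p.1 p.2 | p <- zip h h'].

Definition same_cut (b : sides) (h h' : history) : Prop :=
  [/\ b.1.1 != b.1.2 -> link12 h = link12 h',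
      b.1.2 != b.2 -> link23 h = link23 h' &
      b.2 != b.1.1 -> link31 h = link31 h'].

Variable b : sides.

Lemma size_mix h h' : size h = size h' -> size (mix b h h') = size h.
Proof. by move=> s; rewrite size_map size_zip s minnn. Qed.

Lemma mix_rcons h h' r r' : size h = size h' ->
  mix b (rcons h r) (rcons h' r') = rcons (mix b h h') (mix_round b r r').
Proof. by move=> s; rewrite /mix zip_rcons// map_rcons. Qed.

Lemma mix_invol h h' : size h = size h' -> mix b (mix b h h') (mix b h' h) = h.
Proof.
elim: h h' => [|r h IH] [|r' h'] //= [s]; rewrite /mix /= -/(mix b h h') -/(mix b h' h).
rewrite -/(mix b (mix b h h') (mix b h' h)) IH//; congr cons.
by case: r => -[x y] z; case: r' => -[x' y'] z'; rewrite /mix_round /=;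
  case: b => -[[] []] [].
Qed.

Lemma same_cut_cons h h' r r' : same_cut b (r :: h) (r' :: h') ->
  same_cut b [:: r] [:: r'] /\ same_cut b h h'.
Proof.
by move=> [h1 h2 h3]; split; split => e;
  [case: (h1 e)|case: (h2 e)|case: (h3 e)|case: (h1 e)|case: (h2 e)|case: (h3 e)] => //= -> ->.
Qed.

(** A message crossing the cut is the same in both histories, so each party sees in the mixture
    exactly what it saw in the history its moves come from. *)
Lemma views_mix h h' : size h = size h' -> same_cut b h h' ->
  [/\ viewA (mix b h h') = viewA (if b.1.1 then h' else h),
      viewB (mix b h h') = viewB (if b.1.2 then h' else h) &
      viewC (mix b h h') = viewC (if b.2 then h' else h)].
Proof.
elim: h h' => [|r h IH] [|r' h'] //= => [_ _|[s]]; first by split; rewrite if_same.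
move=> /same_cut_cons[c1 c2]; have [ia ib ic] := IH _ s c2.
rewrite -/(mix b h h').
rewrite /viewA /viewB /viewC /= -/(viewA _) -/(viewB _) -/(viewC _) ia ib ic.
clear -c1; case: c1 => /=; case: b => -[[] []] [] /= h1 h2 h3;
  move: h1 h2 h3; rewrite /mix_round /link12 /link23 /link31 /=
    /m12 /m13 /m21 /m23 /m31 /m32 /mA /mB /mC /= => h1 h2 h3;
  try (have [] := h1 isT); try (have [] := h2 isT); try (have [] := h3 isT);
  by move=> *; split; congr cons; congruence.
Qed.


Lemma same_cut_sym h h' : same_cut b h h' -> same_cut b h' h.
Proof. by move=> [h1 h2 h3]; split=> e; rewrite ?h1 ?h2 ?h3. Qed.

Lemma same_cut_take n h h' : same_cut b h h' -> same_cut b (take n h) (take n h').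
Proof.
by move=> [h1 h2 h3]; split=> e; rewrite /link12 /link23 /link31 !map_take;
  [have := h1 e|have := h2 e|have := h3 e]; rewrite /link12 /link23 /link31 => ->.
Qed.

End Mix.

Section MixLaw.
Variables (R : realType) (X Y Z : finType) (P : protocol R X Y Z).
Local Notation history := (history X Y Z).
Local Notation round := (round X Y Z).
Variable b : sides.

Lemma haltedA_view (h : history) : haltedA h = has (fun t => is_halt t.1.1) (viewA h).
Proof. by rewrite has_map. Qed.

Lemma haltedB_view (h : history) : haltedB h = has (fun t => is_halt t.1.1) (viewB h).
Proof. by rewrite has_map. Qed.

Lemma haltedC_view (h : history) : haltedC h = has (fun t => is_halt t.1.1) (viewC h).
Proof. by rewrite has_map. Qed.

Lemma outA_view (h : history) : outA h = first_halt [seq t.1.1 | t <- viewA h].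
Proof. by rewrite -map_comp. Qed.

Lemma outB_view (h : history) : outB h = first_halt [seq t.1.1 | t <- viewB h].
Proof. by rewrite -map_comp. Qed.

Lemma outC_view (h : history) : outC h = first_halt [seq t.1.1 | t <- viewC h].
Proof. by rewrite -map_comp. Qed.

Lemma rstep_mix h h' r r' : size h = size h' -> same_cut b h h' ->
  rstep P (mix b h h') (mix_round b r r') * rstep P (mix b h' h) (mix_round b r' r) =
  rstep P h r * rstep P h' r'.
Proof.
move=> s c; have [va vb vc] := views_mix s c.
have [va' vb' vc'] := views_mix (esym s) (same_cut_sym c).
have sA g g' m : viewA g = viewA g' -> stepA P g m = stepA P g' m.
  by move=> e; rewrite /stepA !haltedA_view e.
have sB g g' m : viewB g = viewB g' -> stepB P g m = stepB P g' m.
  by move=> e; rewrite /stepB !haltedB_view e.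
have sC g g' m : viewC g = viewC g' -> stepC P g m = stepC P g' m.
  by move=> e; rewrite /stepC !haltedC_view e.
rewrite /rstep (sA _ _ _ va) (sB _ _ _ vb) (sC _ _ _ vc).
rewrite (sA _ _ _ va') (sB _ _ _ vb') (sC _ _ _ vc').
by case: (b) => -[[] []] [] /=; rewrite /mA /mB /mC /=; ring.
Qed.

Lemma hprob_mix_cut h h' : size h = size h' -> same_cut b h h' ->
  hprob P (mix b h h') * hprob P (mix b h' h) = hprob P h * hprob P h'.
Proof.
elim/last_ind: h h' => [|h r IH]; elim/last_ind => [|h' r' _] //; rewrite ?size_rcons//.
move=> [s] c.
have c' : same_cut b h h'.
  have := same_cut_take (size h) c; rewrite -!cats1 take_size_cat//.
  by rewrite s take_size_cat.
rewrite !mix_rcons// !hprob_rcons mulrACA IH// rstep_mix//; ring.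
Qed.

Lemma hprob_mix h h' : size h = size h' ->
  same_cut b (take (size h).-1 h) (take (size h).-1 h') ->
  hprob P (mix b h h') * hprob P (mix b h' h) = hprob P h * hprob P h'.
Proof.
elim/last_ind: h h' => [|h r _]; elim/last_ind => [|h' r' _] //; rewrite ?size_rcons//.
move=> [s] /=; rewrite -!cats1 take_size_cat// s take_size_cat// !cats1 => c.
rewrite !mix_rcons// !hprob_rcons mulrACA hprob_mix_cut// rstep_mix//; ring.
Qed.

Hypothesis kA : kernel_ok (kerA P).
Hypothesis kB : kernel_ok (kerB P).
Hypothesis kC : kernel_ok (kerC P).
Hypothesis term : terminates P.
Local Notation pr := (prob (hist_pmf P)).

(* The exchange is an involution on pairs of histories with equal transcripts on
   the links it cuts, and it preserves the product of the probabilities because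
   no party sees a difference. The moves of the last round are not seen by any
   kernel, hence [n.-1]. *)
Lemma swap_rect n (K D D' E E' : set history) :
  (forall h h', size h = n -> size h' = n -> K h -> K h' ->
    [/\ same_cut b (take n.-1 h) (take n.-1 h'), K (mix b h h'),
        (D' h' -> D' (mix b h h')) /\ (D h' -> D (mix b h h')) &
        (E h -> E (mix b h h')) /\ (E' h -> E' (mix b h h'))]) ->
  pr [set h | let g := pad n h in [/\ K g, D g & E g]] *
  pr [set h | let g := pad n h in [/\ K g, D' g & E' g]] =
  pr [set h | let g := pad n h in [/\ K g, D' g & E g]] *
  pr [set h | let g := pad n h in [/\ K g, D g & E' g]].
Proof.
move=> hK; apply: EFin_inj; rewrite !EFinM /=.
have hp h : (0 <= (hprob P h)%:E)%E by rewrite lee_fin hprob_ge0.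
have prodE (A B : set history) (t : R) : 0 <= t ->
  (\esum_(h in B) (hprob P h)%:E = t%:E)%E ->
  ((\esum_(h in A) (hprob P h)%:E) * t%:E =
   \esum_(k in A `*`` (fun=> B)) (hprob P k.1 * hprob P k.2)%:E)%E.
  move=> t0 Bt.
  rewrite -(@esum_esum _ _ _ A (fun=> B) (fun s t => (hprob P s * hprob P t)%:E)); last first.
    by move=> s u _ _; rewrite lee_fin mulr_ge0 ?hprob_ge0.
  rewrite muleC -ge0_esumZl//; apply: eq_esum => h _.
  by under eq_esum do rewrite EFinM; rewrite ge0_esumZl ?hprob_ge0// Bt muleC.
have lawE (D0 E0 : set history) := esym (pad_lawE kA kB kC term n (fun g => [/\ K g, D0 g & E0 g])).
have pr0 (A : set history) : 0 <= pr A.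
  by apply: pr_ge0; [exact: hist_pmf_ge0|exact: hist_pmf_sum].
rewrite -(lawE D E) -(lawE D' E) (prodE _ _ _ _ (lawE D' E'))//.
rewrite (prodE _ _ _ _ (lawE D E'))//.
have inv (h h' : history) : size h = n -> size h' = n -> mix b (mix b h h') (mix b h' h) = h.
  by move=> s s'; rewrite mix_invol// s.
(* The reindexing is the exchange itself: [D] and [D'] travel with the exchanged parties, [E] and
   [E'] stay with the others. *)
rewrite [RHS](reindex_esum ([set h | size h = n /\ [/\ K h, D h & E h]] `*``
        (fun=> [set h | size h = n /\ [/\ K h, D' h & E' h]]))
  _ (fun k => (mix b k.1 k.2, mix b k.2 k.1))).
  apply: eq_esum => -[h h'] /= [[s [k d e]] [s' [k' d' e']]].
  by rewrite -hprob_mix ?s// ?s'//; have [] := hK h h' s s' k k'.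
split.
- move=> [h h'] /= [[s [k d e]] [s' [k' d' e']]]; rewrite !size_mix ?s ?s'//.
  have [_ k1 [d1 _] [e1 _]] := hK h h' s s' k k'.
  have [_ k2 [_ d2] [_ e2]] := hK h' h s' s k' k.
  by split; split => //; split => //; auto.
- move=> [h h'] [g g'] /[!inE] /= -[[s _] [s' _]] [[t _] [t' _]] [e1 e2].
  have -> : h = g by rewrite -(inv h h' s s') e1 e2 inv.
  by have -> : h' = g' by rewrite -(inv h' h s' s) e1 e2 inv.
- move=> [h h'] /= [[s [k d e]] [s' [k' d' e']]].
  exists (mix b h h', mix b h' h); last by rewrite /= !inv.
  rewrite /= !size_mix ?s ?s'//.
  have [_ k1 [_ d1] [e1 _]] := hK h h' s s' k k'.
  have [_ k2 [d2 _] [_ e2]] := hK h' h s' s k' k.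
  by split; split => //; split => //; auto.
Qed.

(** [f] follows the exchanged parties, [g] the others, and [k] fixes the cut: this is [swap_rect]
    with trivial [D'] and [E']. *)
Lemma mix_cind n (S T U : Type) (f : history -> S) (g : history -> T) (k : history -> U) :
  (forall h h', size h = n -> size h' = n -> k h = k h' ->
    [/\ same_cut b (take n.-1 h) (take n.-1 h'), k (mix b h h') = k h,
        f (mix b h h') = f h' & g (mix b h h') = g h]) ->
  cind_pt (hist_pmf P) (f \o pad n) (g \o pad n) (k \o pad n).
Proof.
move=> hk s t u.
have := @swap_rect n [set h | k h = u] [set h | f h = s] setT [set h | g h = t] setT.
rewrite /= (_ : [set h | [/\ k (pad n h) = u, f (pad n h) = s & g (pad n h) = t]] =
  [set w | [/\ (f \o pad n) w = s, (g \o pad n) w = t & (k \o pad n) w = u]]); last first.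
  by apply/seteqP; split => h /= [].
rewrite (_ : [set h | [/\ k (pad n h) = u, [set: history] (pad n h) & [set: history] (pad n h)]] =
  [set w | (k \o pad n) w = u]); last first.
  by apply/seteqP; split => h /= => [[]|].
rewrite (_ : [set h | [/\ k (pad n h) = u, [set: history] (pad n h) & g (pad n h) = t]] =
  [set w | (g \o pad n) w = t /\ (k \o pad n) w = u]); last first.
  by apply/seteqP; split => h /= [].
rewrite (_ : [set h | [/\ k (pad n h) = u, f (pad n h) = s & [set: history] (pad n h)]] =
  [set w | (f \o pad n) w = s /\ (k \o pad n) w = u]); last first.
  by apply/seteqP; split => h /= [].
move=> ->; first by rewrite mulrC.
move=> h h' sh sh' kh kh'; have [c k1 f1 g1] := hk h h' sh sh' (etrans kh (esym kh')).
by split => //; [rewrite k1 | rewrite f1 | rewrite g1].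
Qed.

End MixLaw.

(** * The interaction inequality for the three links *)

Section Interaction3.
Variables (R : realType) (W : choiceType) (mu : W -> R).
Hypothesis mu_ge0 : forall w, 0 <= mu w.
Hypothesis mu_sum : (\esum_(w in setT) (mu w)%:E = 1)%E.

(** For finite entropies the three inequalities are equivalent, interaction information being
    symmetric. As entropies may be infinite here, all three are carried along. *)
Definition interaction3 (S T U : Type) (a : W -> S) (b : W -> T) (c : W -> U) : Prop :=
  [/\ interaction mu a b c, interaction mu b c a & interaction mu c a b].

Lemma interaction3_rot (S T U : Type) (a : W -> S) (b : W -> T) (c : W -> U) :
  interaction3 a b c -> interaction3 b c a.
Proof. by case. Qed.

Lemma interaction3_swap (S T U : Type) (a : W -> S) (b : W -> T) (c : W -> U) :
  interaction3 a b c -> interaction3 b a c.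
Proof. by case=> h1 h2 h3; split; apply: interaction_sym. Qed.

Lemma cind_sym (S T U : Type) (f : W -> S) (g : W -> T) (k : W -> U) :
  cind mu f g k -> cind mu g f k.
Proof.
move=> h w mw; rewrite [RHS]mulrC -h//; congr (_ * _).
by apply: pf_eq => //; solve_det.
Qed.

Lemma cind_condC (S T U V : Type) (f : W -> S) (g : W -> T) (k : W -> U) (l : W -> V) :
  cind mu f g (k &&& l) -> cind mu f g (l &&& k).
Proof.
move=> h w mw; have := h w mw.
rewrite (@pf_eq _ _ mu mu_ge0 mu_sum _ _ (f &&& g &&& (k &&& l)) (f &&& g &&& (l &&& k)))//;
  try solve_det.
rewrite (@pf_eq _ _ mu mu_ge0 mu_sum _ _ (k &&& l) (l &&& k))//; try solve_det.
rewrite (@pf_eq _ _ mu mu_ge0 mu_sum _ _ (f &&& (k &&& l)) (f &&& (l &&& k)))//; try solve_det.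
by rewrite (@pf_eq _ _ mu mu_ge0 mu_sum _ _ (g &&& (k &&& l)) (g &&& (l &&& k)))//; solve_det.
Qed.

(** [d] is sent by the party that sees [a] and [b]. The three conclusions are the three cases of a
    message, according to whether the target is [b], [c] or [a]. *)
Lemma interaction3_step (S T U V : Type) (a : W -> S) (b : W -> T) (c : W -> U) (d : W -> V) :
  cind mu d c (a &&& b) -> interaction3 a b c -> interaction3 (a &&& d) b c.
Proof.
move=> dc [iab ibc ica]; split.
- exact: (interaction_adjacent mu_ge0 mu_sum dc iab).
- apply: (interaction_sym mu_ge0 mu_sum).
  apply: (interaction_opposite mu_ge0 mu_sum (cind_sym dc)).
  exact: (interaction_sym mu_ge0 mu_sum ibc).
apply: (interaction_sym mu_ge0 mu_sum).
have := interaction_target mu_ge0 mu_sum (cind_condC dc) (interaction_sym mu_ge0 mu_sum ica).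
by apply: (interaction_eq mu_ge0 mu_sum); solve_det.
Qed.

Lemma interaction3_eq (S T U S' T' U' : Type) (a : W -> S) (b : W -> T) (c : W -> U)
    (a' : W -> S') (b' : W -> T') (c' : W -> U') :
  det mu a a' -> det mu a' a -> det mu b b' -> det mu b' b -> det mu c c' -> det mu c' c ->
  interaction3 a b c -> interaction3 a' b' c'.
Proof. move=> a1 a2 b1 b2 c1 c2 [iab ibc ica].
by split; [apply: (interaction_eq mu_ge0 mu_sum _ _ _ _ _ _ iab)|
  apply: (interaction_eq mu_ge0 mu_sum _ _ _ _ _ _ ibc)|
  apply: (interaction_eq mu_ge0 mu_sum _ _ _ _ _ _ ica)]. Qed.

Lemma interaction_const (S T U : Type) (a : W -> S) (s : W -> T) (c : W -> U) :
  (forall w w', a w = a w') -> interaction mu a s c.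
Proof.
move=> aw; apply: leeD; apply: condH_le => //; try solve_det.
by move=> x y _ _ e; rewrite /jnt e (aw x y).
Qed.

End Interaction3.

Section LinkInteraction.
Variables (R : realType) (X Y Z : finType) (P : protocol R X Y Z).
Local Notation history := (history X Y Z).
Local Notation round := (round X Y Z).

(** A link within one side follows that side. On a cut link the two histories agree, so either
    endpoint may select the history. *)
Lemma link_mix (b : sides) (h h' : history) : size h = size h' -> same_cut b h h' ->
  [/\ link12 (mix b h h') = link12 (if b.1.1 then h' else h),
      link23 (mix b h h') = link23 (if b.1.2 then h' else h) &
      link31 (mix b h h') = link31 (if b.2 then h' else h)].
Proof.
elim: h h' => [|r h IH] [|r' h'] //= => [_ _|[s]]; first by split; rewrite if_same.
move=> /same_cut_cons[c1 c2]; have [ia ib ic] := IH _ s c2.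
rewrite -/(mix b h h').
rewrite /link12 /link23 /link31 /= -/(link12 _) -/(link23 _) -/(link31 _) ia ib ic.
clear -c1; case: c1 => /=; case: b => -[[] []] [] /= h1 h2 h3;
  move: h1 h2 h3; rewrite /mix_round /link12 /link23 /link31 /=
    /m12 /m13 /m21 /m23 /m31 /m32 /mA /mB /mC /= => h1 h2 h3;
  try (have [] := h1 isT); try (have [] := h2 isT); try (have [] := h3 isT);
  by move=> *; split; congr cons; congruence.
Qed.

Hypothesis kA : kernel_ok (kerA P).
Hypothesis kB : kernel_ok (kerB P).
Hypothesis kC : kernel_ok (kerC P).
Hypothesis term : terminates P.

(** Made for the middle of a round, when only some of its messages have been revealed: the kernels
    have seen the first n rounds, so the cut has to agree on these alone. *)
Lemma mix_cind_step (b : sides) n (S T U : Type) (f : history -> round -> S)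
    (g : history -> round -> T) (k : history -> round -> U) :
  (forall h h' r r', size h = n -> size h' = n -> k h r = k h' r' ->
    [/\ same_cut b h h', k (mix b h h') (mix_round b r r') = k h r,
        f (mix b h h') (mix_round b r r') = f h' r' &
        g (mix b h h') (mix_round b r r') = g h r]) ->
  cind (hist_pmf P) (fun h => f (pad n h) (nth (idle_round X Y Z) h n))
              (fun h => g (pad n h) (nth (idle_round X Y Z) h n))
              (fun h => k (pad n h) (nth (idle_round X Y Z) h n)).
Proof.
move=> hk; apply: cind_ptW.
pose F (V : Type) (u : history -> round -> V) (H : history) :=
  u (take n H) (nth (idle_round X Y Z) H n).
have FE V (u : history -> round -> V) :
    (fun h => u (pad n h) (nth (idle_round X Y Z) h n)) = F V u \o pad n.+1.
  apply/funext => h; rewrite /F /= padS -cats1 take_size_cat ?size_pad//.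
  by rewrite nth_cat size_pad ltnn subnn.
rewrite !FE; apply: (mix_cind (b := b)) => //.
move=> h h'; case/lastP: h => [|h r]//; case/lastP: h' => [|h' r']//.
rewrite !size_rcons /= => -[s] [s'].
have ss' : size h = size h' by rewrite s s'.
have FR V u (g0 : history) r0 : size g0 = n -> F V u (rcons g0 r0) = u g0 r0.
  by move=> gn; rewrite /F -cats1 take_size_cat// nth_cat gn ltnn subnn.
rewrite mix_rcons// !FR ?size_mix// => kk.
have [c k1 f1 g1] := hk _ _ _ _ s s' kk.
by split => //; rewrite -!cats1 !take_size_cat.
Qed.

Local Notation A n := (fun h : history => link12 (pad n h)).
Local Notation B n := (fun h : history => link23 (pad n h)).
Local Notation C n := (fun h : history => link31 (pad n h)).
Local Notation D m n := (fun h : history => m (nth (idle_round X Y Z) h n)).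

(* Within a round the six messages are added one at a time, in the order Alice,
   Bob, Charlie. *)
Lemma interaction3_links n : interaction3 (hist_pmf P) (A n) (B n) (C n).
Proof.
have m0 := hist_pmf_ge0 kA kB kC; have m1 := hist_pmf_sum term.
elim: n => [|n IH]; first by split; exact: interaction_const.
pose d12 := D (@m12 X Y Z) n; pose d13 := D (@m13 X Y Z) n.
pose d21 := D (@m21 X Y Z) n; pose d23 := D (@m23 X Y Z) n.
pose d31 := D (@m31 X Y Z) n; pose d32 := D (@m32 X Y Z) n.
pose a := A n; pose b := B n; pose c := C n.
(* Each message is independent of the link its sender does not see, with what this round has already
   added to it, given the sender's two links. The mask singles out the sender. *)
have c12 : cind (hist_pmf P) d12 b (a &&& c).
  apply: (@mix_cind_step (true, false, false) n _ _ _ (fun _ r => m12 r)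
    (fun h _ => link23 h) (fun h _ => (link12 h, link31 h))).
  move=> h h' r r' s s' /= [e1 e2].
  have sc : same_cut (true, false, false) h h' by split.
  have [l1 l2 l3] := link_mix (etrans s (esym s')) sc.
  by split => //=; rewrite ?l1 ?l2 ?l3 /= ?e1.
have c13 : cind (hist_pmf P) d13 b (c &&& (a &&& d12)).
  apply: (@mix_cind_step (true, false, false) n _ _ _ (fun _ r => m13 r)
    (fun h _ => link23 h) (fun h r => (link31 h, (link12 h, m12 r)))).
  move=> h h' r r' s s' /= [e1 e2 e3].
  have sc : same_cut (true, false, false) h h' by split.
  have [l1 l2 l3] := link_mix (etrans s (esym s')) sc.
  by split => //=; rewrite ?l1 ?l2 ?l3 /= ?e2 ?e3.
have c21 : cind (hist_pmf P) d21 (c &&& d13) (a &&& d12 &&& b).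
  apply: (@mix_cind_step (false, true, false) n _ _ _ (fun _ r => m21 r)
    (fun h r => (link31 h, m13 r)) (fun h r => (link12 h, m12 r, link23 h))).
  move=> h h' r r' s s' /= [e1 e2 e3].
  have sc : same_cut (false, true, false) h h' by split.
  have [l1 l2 l3] := link_mix (etrans s (esym s')) sc.
  by split => //=; rewrite ?l1 ?l2 ?l3 /= ?e3.
have c23 : cind (hist_pmf P) d23 (c &&& d13) (b &&& (a &&& d12 &&& d21)).
  apply: (@mix_cind_step (false, true, false) n _ _ _ (fun _ r => m23 r)
    (fun h r => (link31 h, m13 r)) (fun h r => (link23 h, (link12 h, m12 r, m21 r)))).
  move=> h h' r r' s s' /= [e1 e2 e3 e4].
  have sc : same_cut (false, true, false) h h' by split.
  have [l1 l2 l3] := link_mix (etrans s (esym s')) sc.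
  by split => //=; rewrite ?l1 ?l2 ?l3 /= ?e1 ?e4.
have c32 : cind (hist_pmf P) d32 (a &&& d12 &&& d21) (b &&& d23 &&& (c &&& d13)).
  apply: (@mix_cind_step (false, false, true) n _ _ _ (fun _ r => m32 r)
    (fun h r => (link12 h, m12 r, m21 r)) (fun h r => (link23 h, m23 r, (link31 h, m13 r)))).
  move=> h h' r r' s s' /= [e1 e2 e3 e4].
  have sc : same_cut (false, false, true) h h' by split.
  have [l1 l2 l3] := link_mix (etrans s (esym s')) sc.
  by split => //=; rewrite ?l1 ?l2 ?l3 /= ?e3.
have c31 : cind (hist_pmf P) d31 (a &&& d12 &&& d21) (c &&& d13 &&& (b &&& d23 &&& d32)).
  apply: (@mix_cind_step (false, false, true) n _ _ _ (fun _ r => m31 r)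
    (fun h r => (link12 h, m12 r, m21 r))
    (fun h r => (link31 h, m13 r, (link23 h, m23 r, m32 r)))).
  move=> h h' r r' s s' /= [e1 e2 e3 e4 e5].
  have sc : same_cut (false, false, true) h h' by split.
  have [l1 l2 l3] := link_mix (etrans s (esym s')) sc.
  by split => //=; rewrite ?l1 ?l2 ?l3 /= ?e1 ?e5.
have i0 : interaction3 (hist_pmf P) a c b.
  exact: (interaction3_swap m0 m1 (interaction3_rot (interaction3_rot IH))).
have i1 : interaction3 (hist_pmf P) c (a &&& d12) b.
  exact: (interaction3_swap m0 m1 (interaction3_step m0 m1 c12 i0)).
have i2 : interaction3 (hist_pmf P) (a &&& d12) b (c &&& d13).
  exact: (interaction3_rot (interaction3_step m0 m1 c13 i1)).
have i3 : interaction3 (hist_pmf P) b (a &&& d12 &&& d21) (c &&& d13).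
  exact: (interaction3_swap m0 m1 (interaction3_step m0 m1 c21 i2)).
have i4 : interaction3 (hist_pmf P) (b &&& d23) (c &&& d13) (a &&& d12 &&& d21).
  apply: interaction3_rot; apply: interaction3_rot.
  exact: (interaction3_swap m0 m1 (interaction3_rot (interaction3_step m0 m1 c23 i3))).
have i5 : interaction3 (hist_pmf P) (c &&& d13) (b &&& d23 &&& d32) (a &&& d12 &&& d21).
  exact: (interaction3_swap m0 m1 (interaction3_step m0 m1 c32 i4)).
have := interaction3_step m0 m1 c31 i5.
move=> /interaction3_rot /(interaction3_swap m0 m1).
by apply: (interaction3_eq m0 m1) => h h' _ _;
  rewrite !padS /link12 /link23 /link31 !map_rcons -/(link12 _) -/(link23 _) -/(link31 _)
    /jnt /a /b /c /d12 /d13 /d21 /d23 /d31 /d32;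
  first [by move=> [-> -> ->] | by move=> /rcons_inj [-> -> ->]].
Qed.

End LinkInteraction.

(** * From determined outputs, privacy and interaction to the bound *)

Section Abstract.
Variables (R : realType) (W : choiceType) (mu : W -> R).
Hypothesis mu_ge0 : forall w, 0 <= mu w.
Hypothesis mu_sum : (\esum_(w in setT) (mu w)%:E = 1)%E.
Local Notation pr := (prob mu).
Local Notation pf := (fiber_prob mu).
Local Notation condH := (cond_entropy mu).
Local Notation ent_rv f := (condH f (@const_rv W)).

Lemma cind_pt_sym (S T U : Type) (f : W -> S) (g : W -> T) (k : W -> U) :
  cind_pt mu f g k -> cind_pt mu g f k.
Proof.
move=> h s t u; rewrite [RHS]mulrC -h; congr (_ * _).
by congr pr; apply/seteqP; split => w [].
Qed.

Lemma cind_pt_map (S : choiceType) (S' T U : Type) (f : W -> S) (F : S -> S') (g : W -> T)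
  (k : W -> U) : cind_pt mu f g k -> cind_pt mu (F \o f) g k.
Proof.
move=> h s t u; apply: EFin_inj; rewrite !EFinM.
have m0 w : (0 <= (mu w)%:E)%E by rewrite lee_fin.
have sumE (E : set W) : (pr [set w | F (f w) = s /\ E w])%:E =
    (\esum_(v in [set v | F v = s]) (pr [set w | f w = v /\ E w])%:E)%E.
  rewrite prE// (esum_fiber _ f)// [RHS]esum_mkcond; apply: eq_esum => v _.
  have [Fv|Fv] := pselect (F v = s); [rewrite mem_set//|rewrite memNset//].
    rewrite prE//; congr esum; apply/seteqP; split => w /=; first by move=> [[_ ?] ->].
    by move=> [fv Ew]; rewrite fv.
  by apply: esum1 => w [[/= Fs _] fv]; exfalso; apply: Fv; rewrite -fv.
have e1 : [set w | [/\ (F \o f) w = s, g w = t & k w = u]] =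
    [set w | F (f w) = s /\ [set w | g w = t /\ k w = u] w].
  by apply/seteqP; split => w /= [] // ? [].
rewrite e1 (sumE [set w | g w = t /\ k w = u]) (sumE [set w | k w = u]).
rewrite muleC [RHS]muleC -!ge0_esumZl ?pr_ge0//; try by move=> v; rewrite lee_fin pr_ge0.
apply: eq_esum => v _; rewrite -!EFinM; congr EFin.
rewrite mulrC [RHS]mulrC -h; congr (pr _ * _).
by apply/seteqP; split => w /= [] // ? [].
Qed.

Lemma det_factor (S U : Type) (u0 : U) (T : W -> S) (x : W -> U) :
  det mu T x -> exists F : S -> U, forall w, 0 < mu w -> x w = F (T w).
Proof.
move=> d; have /choice[F FP] : forall s, exists u, forall w, 0 < mu w -> T w = s -> x w = u.
  move=> s.
  have [[w [mw Tw]]|nex] := pselect (exists w, 0 < mu w /\ T w = s).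
    by exists (x w) => w' mw' Tw'; apply: d => //; rewrite Tw.
  by exists u0 => w mw Tw; exfalso; apply: nex; exists w.
by exists F => w mw; apply: FP.
Qed.

(* Given the transcripts T of its links, an output is independent of the other
   outputs by the exchange argument, and by privacy T does not change the law of
   the other outputs given this one: two values compatible with the same T give
   proportional slices of the joint law. *)
Lemma output_determined (U V S : Type) (o : W -> U) (q : W -> V) (T : W -> S) :
  (forall u u' v t,
    pr [set w | [/\ o w = u, q w = v & T w = t]] * pr [set w | o w = u' /\ T w = t] =
    pr [set w | [/\ o w = u', q w = v & T w = t]] * pr [set w | o w = u /\ T w = t]) ->
  cind_pt mu q T o ->
  (forall u u', (exists c, 0 <= c /\ forall v,
     pr [set w | o w = u /\ q w = v] = c * pr [set w | o w = u' /\ q w = v]) -> u = u') ->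
  det mu T o.
Proof.
move=> rect priv normal w w' mw mw' TT; apply: normal.
have pos (E : set W) v : E v -> 0 < mu v -> 0 < pr E by exact: pr_gt0.
have pu : 0 < pr [set x | o x = o w] by exact: (pos _ w).
have pu' : 0 < pr [set x | o x = o w'] by exact: (pos _ w').
have put : 0 < pr [set x | o x = o w /\ T x = T w] by exact: (pos _ w).
have put' : 0 < pr [set x | o x = o w' /\ T x = T w] by apply: (pos _ w').
(* The ratio of the masses of the two values, since [q] has the same conditional law given either of
   them. *)
exists (pr [set x | o x = o w] / pr [set x | o x = o w']); split.
  by rewrite divr_ge0// ltW.
move=> v; have := rect (o w) (o w') v (T w).
have := priv v (T w) (o w); have := priv v (T w) (o w').
have e1 u : [set x | [/\ q x = v, T x = T w & o x = u]] =
  [set x | [/\ o x = u, q x = v & T x = T w]] by apply/seteqP; split => x [].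
have e2 u : [set x | q x = v /\ o x = u] = [set x | o x = u /\ q x = v].
  by apply/seteqP; split => x [].
have e3 u : [set x | T x = T w /\ o x = u] = [set x | o x = u /\ T x = T w].
  by apply/seteqP; split => x [].
rewrite !e1 !e2 !e3.
move: (pr [set x | [/\ o x = o w, q x = v & T x = T w]]) => a.
move: (pr [set x | [/\ o x = o w', q x = v & T x = T w]]) => a'.
move: (pr [set x | o x = o w /\ q x = v]) => b.
move: (pr [set x | o x = o w' /\ q x = v]) => b'.
move: pu pu' put put'.
move: (pr [set x | o x = o w /\ T x = T w]) => d.
move: (pr [set x | o x = o w' /\ T x = T w]) => d'.
move: (pr [set x | o x = o w]) => u; move: (pr [set x | o x = o w']) => u'.
move=> u0 u0' d0 d0' h' h r.
have dn : d * d' != 0 by rewrite mulf_neq0 ?gt_eqF.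
have u'n : u' != 0 by rewrite gt_eqF.
suff e : b * u' = u * b' by rewrite mulrAC -e mulfK.
apply: (mulIf dn).
transitivity (b * d * (d' * u')); first by ring.
rewrite -h; transitivity (u * u' * (a * d')); first by ring.
rewrite r; transitivity (a' * u' * u * d); first by ring.
by rewrite h'; ring.
Qed.

Lemma condH_triangle (S T U : Type) (f : W -> S) (g : W -> T) (h : W -> U) :
  (condH f h <= condH f g + condH g h)%E.
Proof.
apply: (@le_trans _ _ (condH (f &&& g) h)); first by apply: condH_le => //; solve_det.
by rewrite condH_chain//; apply: leeD => //; apply: condH_le => //; solve_det.
Qed.

Lemma condH_det_chain (S T U : Type) (f : W -> S) (g : W -> T) (h : W -> U) :
  det mu (f &&& h) g -> condH f h = (condH f (g &&& h) + condH g h)%E.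
Proof.
move=> d; rewrite -condH_chain//; apply: condH_eq => //; try solve_det.
by move=> w w' mw mw' e; rewrite /jnt (d w w')//; case: e => ->.
Qed.

(* H(B) = I(A;B) + I(B;C|A) + H(B|AC). The last two terms are at least I(x;y|A)
   and H(y,z|x) since x, y, z are determined by AC, AB, BC. For the first one,
   I(A;B) >= I(An;Bn) >= I(An;Bn|Cn) >= I(xn;zn|Cn), and xn, zn are close to
   x, z. *)
Lemma transcript_bound (SA SB SC SA' SB' SC' : Type) (X Y Z : finType)
    (A : W -> SA) (B : W -> SB) (C : W -> SC) (x : W -> X) (y : W -> Y) (z : W -> Z)
    (An : nat -> W -> SA') (Bn : nat -> W -> SB') (Cn : nat -> W -> SC')
    (xn : nat -> W -> X) (zn : nat -> W -> Z) (rxz rxy : R) :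
  det mu (A &&& C) x -> det mu (A &&& B) y -> det mu (B &&& C) z ->
  cind_pt mu (y &&& z) (A &&& C) x ->
  (forall n, interaction mu (An n) (Bn n) (Cn n)) ->
  (forall n, det mu A (An n)) -> (forall n, det mu B (Bn n)) -> (forall n, det mu C (Cn n)) ->
  (forall n, det mu (An n &&& Cn n) (xn n)) ->
  (forall n, det mu (Bn n &&& Cn n) (zn n)) ->
  (forall e : R, 0 < e -> exists n, pr [set w | x w <> xn n w] <= e /\
                               pr [set w | z w <> zn n w] <= e) ->
  (rxz%:E + condH z x <= condH z C)%E -> (rxy%:E + condH y x <= condH y A)%E ->
  ((rxz + rxy)%:E + condH (y &&& z) x <= ent_rv B)%E.
Proof.
move=> dx dy dz priv inter dA dB dC dxn dzn lim hz hy.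
have [Bfin|] := boolP (ent_rv B \is a fin_num); last first.
  by rewrite ge0_fin_numE ?condH_ge0// ltNge negbK leye_eq => /eqP ->; rewrite leey.
have priv' := cind_ptW priv.
(* Privacy gives H(y,z|x) = H(y,z|x,A,C), and given A and C the pair is a function of B. *)
have b0 : (condH (y &&& z) x <= condH B (A &&& C))%E.
  rewrite -(condH_cind mu_ge0 mu_sum priv').
  apply: condH_le => //; first by solve_det.
  move=> w w' mw mw' e; have [eB eA eC _] : [/\ B w = B w', A w = A w', C w = C w' & x w = x w'].
    by move: e; rewrite /jnt => -[-> -> -> ->].
  by rewrite /jnt (dy w w' mw mw') ?(dz w w' mw mw')// /jnt ?eA ?eB ?eC.
(* I(B;C|A) >= H(y|A) - H(y|x): [y] is split off from B on both sides, and [x] is a function of A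
   and C. *)
have b1 : (condH y A + condH B (A &&& C) <= condH y x + condH B A)%E.
  rewrite (@condH_det_chain _ _ _ B y A); last first.
    by move=> w w' mw mw' [e1 e2]; apply: dy; rewrite // /jnt e1 e2.
  rewrite (@condH_det_chain _ _ _ B y (A &&& C)); last first.
    by move=> w w' mw mw' [e1 e2 e3]; apply: dy; rewrite // /jnt e1 e2.
  rewrite [leLHS]addeC [leRHS]addeA; apply: leeD => //.
  rewrite [leLHS]addeC; apply: leeD; apply: condH_le => //; try solve_det.
(* I(A;B) >= H(z|C) - H(z|x). *)
have b2 : (condH z C + condH B A <= ent_rv B + condH z x)%E.
  have fz := ent_fin_num mu_ge0 mu_sum z.
  have [z1 _ g1] := condH_fin mu_ge0 mu_sum C fz.
  have [z2 _ g2] := condH_fin mu_ge0 mu_sum x fz.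
  have [x1 _ e1] := condH_fin mu_ge0 mu_sum A Bfin.
  have [x3 _ e3] := condH_fin mu_ge0 mu_sum (@const_rv W) Bfin.
  (* The sum of three Fano constants: [z] and [zn n] are compared in both directions, [x] given
     [xn n] in one. *)
  pose K : R := 2 * (#|Z| ^ 2)%:R + 2 * (#|Z| ^ 2)%:R + 2 * (#|X| ^ 2)%:R.
  have K0 : 0 <= K by rewrite /K !addr_ge0// mulr_ge0.
  have bound n e : pr [set w | x w <> xn n w] <= e -> pr [set w | z w <> zn n w] <= e ->
      z1 + x1 <= x3 + z2 + K * Num.sqrt e.
    move=> px pz.
    have fzn := ent_fin_num mu_ge0 mu_sum (zn n).
    have Bnfin : ent_rv (Bn n) \is a fin_num.
      rewrite ge0_fin_numE ?condH_ge0//.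
      apply: (@le_lt_trans _ _ (ent_rv B)); last by rewrite -ge0_fin_numE ?condH_ge0.
      by apply: condH_le => // w w' mw mw' e'; apply: (dB n) => //; case: e'.
    have ff (T : finType) (u v : W -> T) : pr [set w | u w <> v w] <= e ->
        (condH u v <= (2 * (#|T| ^ 2)%:R * Num.sqrt e)%:E)%E.
      move=> pe; apply: le_trans (fano mu_ge0 mu_sum u v) _.
      by rewrite lee_fin ler_wpM2l ?mulr_ge0// ler_wsqrtr.
    have h1 : (condH z C <= condH z (zn n) + condH (zn n) (Cn n))%E.
      apply: le_trans (condH_triangle z (zn n) C) _; apply: leeD => //.
      by apply: condH_le => //; solve_det.
    have h2 : (condH (zn n) (xn n &&& Cn n) <=
        condH (zn n) z + (condH z x + condH x (xn n)))%E.
      apply: le_trans (condH_triangle (zn n) z _) _; apply: leeD => //.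
      apply: le_trans (condH_triangle z x _) _; apply: leeD => //.
      by apply: condH_le => //; solve_det.
    (* Data processing, I(An;Bn) <= I(A;B), in additive form. *)
    have h3 : (condH B A + ent_rv (Bn n) <= condH (Bn n) (An n) + ent_rv B)%E.
      rewrite (@condH_det_chain _ _ _ B (Bn n) (@const_rv W)); last first.
        by move=> w w' mw mw' e'; apply: (dB n) => //; case: e'.
      rewrite addeA; apply: leeD => //; rewrite addeC.
      apply: le_trans (condH_triangle B (Bn n) A) _; apply: leeD.
        by apply: condH_le => //; solve_det.
      by apply: condH_le => //; solve_det.
    (* With [h5] this gives I(An;Bn|Cn) >= I(xn;zn|Cn). *)
    have h4 : condH (Bn n) (Cn n) = (condH (Bn n) (zn n &&& Cn n) + condH (zn n) (Cn n))%E.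
      by apply: condH_det_chain.
    have h5 : (condH (Bn n) (An n &&& Cn n) <=
        condH (Bn n) (zn n &&& Cn n) + condH (zn n) (xn n &&& Cn n))%E.
      rewrite (@condH_det_chain _ _ _ (Bn n) (zn n)); last first.
        by move=> w w' mw mw' [e1' e2' e3']; apply: dzn; rewrite // /jnt e1' e3'.
      apply: leeD; first by apply: condH_le => //; solve_det.
      apply: condH_le => //; last by solve_det.
      by move=> w w' mw mw' e'; rewrite /jnt (dxn n w w')//; case: e' => _ ->.
    have h6 := inter n; rewrite /interaction in h6.
    have h7 := ff _ _ _ px.
    have h8 := ff _ _ _ pz.
    have h9 : (condH (zn n) z <= (2 * (#|Z| ^ 2)%:R * Num.sqrt e)%:E)%E.
      apply: ff; apply: le_trans pz; apply: pr_le => // w /= ne e'; apply: ne.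
      by rewrite e'.
    have [q1 _ r1] := condH_fin mu_ge0 mu_sum (zn n) fz.
    have [q2 _ r2] := condH_fin mu_ge0 mu_sum (Cn n) fzn.
    have [q3 _ r3] := condH_fin mu_ge0 mu_sum (xn n &&& Cn n) fzn.
    have [q4 _ r4] := condH_fin mu_ge0 mu_sum z fzn.
    have [q5 _ r5] := condH_fin mu_ge0 mu_sum (xn n) (ent_fin_num mu_ge0 mu_sum x).
    have [q6 _ r6] := condH_fin mu_ge0 mu_sum (@const_rv W) Bnfin.
    have [q7 _ r7] := condH_fin mu_ge0 mu_sum (An n) Bnfin.
    have [q8 _ r8] := condH_fin mu_ge0 mu_sum (Cn n) Bnfin.
    have [q9 _ r9] := condH_fin mu_ge0 mu_sum (zn n &&& Cn n) Bnfin.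
    have [q10 _ r10] := condH_fin mu_ge0 mu_sum (An n &&& Cn n) Bnfin.
    move: h1 h2 h3 h4 h5 h6 h7 h8 h9.
    rewrite g1 g2 e1 e3 r1 r2 r3 r4 r5 r6 r7 r8 r9 r10 -!EFinD !lee_fin => + + + [].
    rewrite /K; lra.
  rewrite g1 g2 e1 e3 -!EFinD lee_fin; apply/ler_addgt0Pr => e e0.
  (* The square cancels the root in [bound], and K + 1 keeps the denominator positive. *)
  have [|n [px pz]] := lim ((e / (K + 1)) ^+ 2).
    by rewrite exprn_gt0// divr_gt0//; lra.
  apply: le_trans (bound n _ px pz) _; rewrite lerD2l sqrtr_sqr ger0_norm; last first.
    by rewrite divr_ge0//; [exact: ltW|lra].
  by rewrite mulrCA ger_pMr// ler_pdivrMr; lra.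
have [x1 _ e1] := condH_fin mu_ge0 mu_sum A Bfin.
have [x2 _ e2] := condH_fin mu_ge0 mu_sum (A &&& C) Bfin.
have [x3 _ e3] := condH_fin mu_ge0 mu_sum (@const_rv W) Bfin.
have [y1 _ f1] := condH_fin mu_ge0 mu_sum A (ent_fin_num mu_ge0 mu_sum y).
have [y2 _ f2] := condH_fin mu_ge0 mu_sum x (ent_fin_num mu_ge0 mu_sum y).
have [z1 _ g1] := condH_fin mu_ge0 mu_sum C (ent_fin_num mu_ge0 mu_sum z).
have [z2 _ g2] := condH_fin mu_ge0 mu_sum x (ent_fin_num mu_ge0 mu_sum z).
have [t _ k] := condH_fin mu_ge0 mu_sum x (ent_fin_num mu_ge0 mu_sum (y &&& z)).
move: hz hy b0 b1 b2; rewrite e1 e2 e3 f1 f2 g1 g2 k -!EFinD !lee_fin; lra.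
Qed.

End Abstract.

Lemma prefix_free_cat (C : set bits) (u v s t : bits) :
  prefix_free C -> C u -> C v -> u ++ s = v ++ t -> u = v /\ s = t.
Proof.
move=> pf Cu Cv e.
suff uv : u = v by split=> //; move: e; rewrite uv => /eqP; rewrite eqseq_cat// => /andP[_ /eqP].
have [l|l] := leqP (size u) (size v).
  apply: pf => //; apply/prefixP; exists (drop (size u) v).
  have := congr1 (take (size u)) e; rewrite take_size_cat// takel_cat// => {1}->.
  by rewrite cat_take_drop.
apply/esym; apply: pf => //; apply/prefixP; exists (drop (size v) u).
have := congr1 (take (size v)) e; rewrite (takel_cat _ (ltnW l)) take_size_cat// => vE.
by rewrite -{1}vE cat_take_drop.
Qed.

(** * Parsing the transcripts *)

Section Parse.
Variables (R : realType) (X Y Z : finType) (P : protocol R X Y Z).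
Hypothesis kA : kernel_ok (kerA P).
Hypothesis kB : kernel_ok (kerB P).
Hypothesis kC : kernel_ok (kerC P).
Local Notation history := (history X Y Z).
Local Notation round := (round X Y Z).
Local Notation idle := (idle_round X Y Z).
Local Notation mu := (hist_pmf P).

Lemma hprob_prefix_gt0 (g e : history) : 0 < hprob P (g ++ e) -> 0 < hprob P g.
Proof.
elim/last_ind: e => [|e r IH]; first by rewrite cats0.
rewrite -rcons_cat hprob_rcons => h; apply: IH.
rewrite lt_neqAle eq_sym hprob_ge0// andbT; apply: contraTneq h => ->.
by rewrite mul0r ltxx.
Qed.

Lemma hist_pmf_gt0 h : 0 < mu h -> terminal h /\ 0 < hprob P h.
Proof. by rewrite /hist_pmf; case: ifP => // _; rewrite ltxx. Qed.

(** These are the premises of [codes_ok], at each round of a run of positive probability. *)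
Lemma support_step h n : 0 < mu h -> (n < size h)%N ->
  [/\ 0 < hprob P (take n h), ~~ all_halted (take n h) & 0 < rstep P (take n h) (nth idle h n)].
Proof.
move=> /hist_pmf_gt0[th ph] nh.
have : 0 < hprob P (rcons (take n h) (nth idle h n)).
  by apply: (@hprob_prefix_gt0 _ (drop n.+1 h)); rewrite -(take_nth idle nh) cat_take_drop.
rewrite hprob_rcons => pr0; have p1 : 0 < hprob P (take n h).
  by apply: (@hprob_prefix_gt0 _ (drop n h)); rewrite cat_take_drop.
split => //; last by rewrite pmulr_rgt0 in pr0.
by rewrite -(pad_take (ltnW nh)) terminal_pad// -ltnNge.
Qed.

Variables (m m' : round -> bits) (c c' : seq (bits * bits) -> set bits).
Let link (h : history) := [seq (m r, m' r) | r <- h].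
Let tr (h : history) := flatten [seq m r ++ m' r | r <- h].
Hypothesis c_pf : forall l, prefix_free (c l).
Hypothesis c'_pf : forall l, prefix_free (c' l).
Hypothesis c_ok : forall h r, 0 < hprob P h -> ~~ all_halted h -> 0 < rstep P h r ->
  c (link h) (m r) /\ c' (link h) (m' r).
Hypothesis m_idle : m idle = [::].
Hypothesis m'_idle : m' idle = [::].

Lemma tr_link h : tr h = flatten [seq p.1 ++ p.2 | p <- link h].
Proof. by rewrite /tr /link -map_comp. Qed.

Lemma tr_idle n : tr (nseq n idle) = [::].
Proof. by elim: n => //= n; rewrite /tr /= m_idle m'_idle. Qed.

Lemma tr_cat g h : tr (g ++ h) = tr g ++ tr h.
Proof. by rewrite /tr map_cat flatten_cat. Qed.

Lemma tr_pad_drop n h : tr h = tr (pad n h) ++ tr (drop n h).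
Proof.
have [nh|nh] := leqP n (size h); first by rewrite pad_take// -tr_cat cat_take_drop.
by rewrite pad_cat ?(ltnW nh)// tr_cat tr_idle drop_oversize ?(ltnW nh)// !cats0.
Qed.

Lemma tr_pad n h : (size h <= n)%N -> tr (pad n h) = tr h.
Proof. by move=> nh; rewrite pad_cat// tr_cat tr_idle cats0. Qed.

(* A prefix-free code containing the empty string contains nothing else, so the
   flat transcript determines the rounds up to trailing rounds of empty
   messages, which the padding makes invisible. *)
Lemma link_pad_det n : det mu tr (fun h => link (pad n h)).
Proof.
move=> h h' mh mh' e; elim: n => [|n IH]; first by rewrite /pad.
rewrite !padS /link !map_rcons -/(link _) -/(link _) IH; congr rcons.
have dr : tr (drop n h) = tr (drop n h').
  have := e; rewrite (tr_pad_drop n h) (tr_pad_drop n h').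
  by rewrite !(tr_link (pad _ _)) IH => /eqP; rewrite eqseq_cat// => /andP[_ /eqP].
(* If one run is over at round n, the rest of both transcripts is empty, so the other run can only
   send empty messages. *)
have nil g g' : (size g <= n)%N -> tr (drop n g) = tr (drop n g') ->
    (m (nth idle g n), m' (nth idle g n)) = (m (nth idle g' n), m' (nth idle g' n)).
  move=> gn; rewrite drop_oversize// nth_default// m_idle m'_idle => /esym.
  have [g'n|g'n] := leqP (size g') n; first by rewrite nth_default// m_idle m'_idle.
  rewrite (drop_nth idle g'n) /tr /=.
  by case: (m _) => //; case: (m' _).
have [hn|hn] := leqP (size h) n; first exact: nil.
have [hn'|hn'] := leqP (size h') n; first by apply/esym; apply: nil.
have [p1 a1 s1] := support_step mh hn; have [p2 a2 s2] := support_step mh' hn'.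
have [c1 d1] := c_ok p1 a1 s1; have [c2 d2] := c_ok p2 a2 s2.
move: c1 d1 c2 d2; rewrite -!pad_take ?(ltnW hn) ?(ltnW hn')// IH => c1 d1 c2 d2.
move: dr; rewrite (drop_nth idle hn) (drop_nth idle hn') /tr /= -!catA => dr.
have [e1 {}dr] := prefix_free_cat (@c_pf _) c1 c2 dr.
by have [e2 _] := prefix_free_cat (@c'_pf _) d1 d2 dr; rewrite e1 e2.
Qed.

End Parse.

(** * The exchange argument for finished runs *)

Section Outputs.
Variables (R : realType) (X Y Z : finType) (P : protocol R X Y Z).
Hypothesis kA : kernel_ok (kerA P).
Hypothesis kB : kernel_ok (kerB P).
Hypothesis kC : kernel_ok (kerC P).
Hypothesis term : terminates P.
Local Notation history := (history X Y Z).
Local Notation round := (round X Y Z).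
Local Notation mu := (hist_pmf P).
Local Notation pr := (prob (hist_pmf P)).

Let m0 := hist_pmf_ge0 kA kB kC.
Let m1 := hist_pmf_sum term.

(** As finished runs have total mass 1, some finite set of histories has mass above 1 - e, and its
    lengths are bounded. *)
Lemma tail_small (e : R) : 0 < e -> exists N, forall n, (N <= n)%N ->
  pr [set h : history | (n < size h)%N] <= e.
Proof.
move=> e0.
have : (((1 - e)%:E : \bar R) < \esum_(h in [set: history]) (mu h)%:E)%E.
  by rewrite m1 lte_fin; lra.
move=> /ereal_sup_gt[_ [F [finF _] <-]] lt.
have /finite_seqP[s sE] := finF.
exists (\max_(h <- s) size h)%N => n Nn.
have : (\sum_(i \in F) (mu i)%:E <= (pr [set h : history | (size h <= n)%N])%:E)%E.
  rewrite prE//; apply: esum_ge; exists F => //; split => // h Fh.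
  apply: leq_trans Nn; apply: leq_bigmax_seq => //.
  by move: Fh; rewrite sE.
move=> /(lt_le_trans lt); rewrite lte_fin => lt2.
have := prID m0 m1 setT [set h : history | (size h <= n)%N].
rewrite prT// !setTI (_ : ~` _ = [set h : history | (n < size h)%N]); first by lra.
by apply/seteqP; split => h /=; rewrite ltnNge => /negP.
Qed.

Lemma pr_size_cvg (E : set history) :
  (fun n => pr [set h | E h /\ (size h <= n)%N]) @ \oo --> pr E.
Proof.
apply/cvgrPdist_le => e e0; have [N NP] := tail_small e0.
exists N => // n /= Nn.
have -> : pr E - pr [set h | E h /\ (size h <= n)%N] =
    pr (E `&` ~` [set h | (size h <= n)%N]).
  by rewrite (prID m0 m1 E [set h : history | (size h <= n)%N]) addrAC subrr add0r.
rewrite ger0_norm ?pr_ge0//.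
apply: le_trans (NP n Nn); apply: pr_le => // h /= [_ /negP].
by rewrite -ltnNge.
Qed.


(** The exchange works at a fixed number of rounds, whereas outputs and transcripts belong to
    finished runs. It is applied to the runs finished by round n, and n tends to infinity. Being
    finished splits into one condition for each side of the cut, [ho] and [hq], and so survives the
    exchange. *)
Lemma rect_identity (b : sides) (K S U V : Type) (k : history -> K) (T : history -> S)
    (o : history -> U) (q : history -> V) (ho hq : history -> bool) (unT : K -> S) :
  (forall h h', size h = size h' -> k h = k h' ->
     [/\ same_cut b h h', k (mix b h h') = k h,
         o (mix b h h') = o h' /\ ho (mix b h h') = ho h' &
         q (mix b h h') = q h /\ hq (mix b h h') = hq h]) ->
  (forall h, all_halted h = ho h && hq h) ->
  (forall n, det mu T (fun h => k (pad n h))) ->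
  (forall h n, terminal h -> (size h <= n)%N ->
     [/\ unT (k (pad n h)) = T h, o (pad n h) = o h & q (pad n h) = q h]) ->
  forall u u' v t,
    pr [set w | [/\ o w = u, q w = v & T w = t]] * pr [set w | o w = u' /\ T w = t] =
    pr [set w | [/\ o w = u', q w = v & T w = t]] * pr [set w | o w = u /\ T w = t].
Proof.
move=> hmix hah hdet hpad u u' v t.
have [[h0 mh0 Th0]|nex] := pselect (exists2 h, 0 < mu h & T h = t); last first.
  have z (E : set history) : (forall h, E h -> T h = t) -> pr E = 0.
    move=> ET; apply/eqP; rewrite eq_le pr_ge0// andbT leNgt; apply/negP.
    by move=> /(pr_gt0_ex m0 m1)[h mh Eh]; apply: nex; exists h => //; apply: ET.
  by rewrite !(z [set w | _ /\ _]) ?mulr0// => h [].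
pose f x := pr [set w | [/\ o w = x, q w = v & T w = t]].
pose g x := pr [set w | o w = x /\ T w = t].
pose fn x n := pr [set w | [/\ o w = x, q w = v & T w = t] /\ (size w <= n)%N].
pose gn x n := pr [set w | (o w = x /\ T w = t) /\ (size w <= n)%N].
have eqn n : (size h0 <= n)%N -> fn u n * gn u' n = fn u' n * gn u n.
  move=> h0n; pose kap := k (pad n h0).
  (* For runs finished by round n, having transcript [t] and having link contents [kap] are the same
     event. *)
  have Tk h : 0 < mu h -> (size h <= n)%N -> T h = t <-> k (pad n h) = kap.
    move=> mh hn; have [th _] := hist_pmf_gt0 mh; have [th0 _] := hist_pmf_gt0 mh0.
    split=> [Tt|kk]; first by apply: (hdet n) => //; rewrite Tt Th0.
    have [<- _ _] := hpad h n th hn; rewrite kk -Th0.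
    by have [<- _ _] := hpad h0 n th0 h0n.
  have fE x : fn x n = pr [set h | let g := pad n h in
      [/\ k g = kap, o g = x /\ ho g & q g = v /\ hq g]].
    apply: pr_supp => // h mh; have [th _] := hist_pmf_gt0 mh.
    split=> [[[ox qv Tt] hn]|/= [kk [ox hox] [qv hqv]]].
      have [_ oE qE] := hpad h n th hn.
      have := terminal_pad n th; rewrite hn hah => /andP[hox hqv].
      by split; [apply/Tk | rewrite oE | rewrite qE].
    have hn : (size h <= n)%N by rewrite -(terminal_pad n th) hah hox hqv.
    have [_ oE qE] := hpad h n th hn.
    by split=> //; split; rewrite -?oE -?qE//; apply/Tk.
  have gE x : gn x n = pr [set h | let g := pad n h in
      [/\ k g = kap, o g = x /\ ho g & hq g]].
    apply: pr_supp => // h mh; have [th _] := hist_pmf_gt0 mh.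
    split=> [[[ox Tt] hn]|/= [kk [ox hox] hqv]].
      have [_ oE qE] := hpad h n th hn.
      have := terminal_pad n th; rewrite hn hah => /andP[hox hqv].
      by split; [apply/Tk | rewrite oE | ].
    have hn : (size h <= n)%N by rewrite -(terminal_pad n th) hah hox hqv.
    have [_ oE qE] := hpad h n th hn.
    by split=> //; split; rewrite -?oE//; apply/Tk.
  rewrite !fE !gE.
  apply: (@swap_rect _ _ _ _ P b kA kB kC term n [set h | k h = kap]
    [set h | o h = u /\ ho h] [set h | o h = u' /\ ho h]
    [set h | q h = v /\ hq h] [set h | hq h]).
  move=> h h' hn h'n /= kh kh'.
  have [c k1 [p1 ho1] [q1 hq1]] := hmix h h' (etrans hn (esym h'n)) (etrans kh (esym kh')).
  split; [exact: same_cut_take|by rewrite k1|by rewrite p1 ho1|by rewrite q1 hq1].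
have cf x : fn x @ \oo --> f x by exact: pr_size_cvg.
have cg x : gn x @ \oo --> g x by exact: pr_size_cvg.
have c1 : (fun n => fn u n * gn u' n) @ \oo --> f u * g u' by exact: cvgM.
have c2 : (fun n => fn u' n * gn u n) @ \oo --> f u' * g u by exact: cvgM.
have c3 : (fun n => fn u n * gn u' n) @ \oo --> f u' * g u.
  apply: cvg_trans c2; apply: near_eq_cvg; exists (size h0) => // n /= h0n.
  by rewrite eqn.
exact: (cvg_unique _ c1 c3).
Qed.

End Outputs.

Lemma first_halt_cat (O : Type) (s t : seq (move O)) :
  has is_halt s -> first_halt (s ++ t) = first_halt s.
Proof. by elim: s => //= -[[a|[]]|[]] s IH //=. Qed.

Lemma first_halt_some (O : Type) (s : seq (move O)) o0 :
  has is_halt s -> first_halt s = Some (odflt o0 (first_halt s)).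
Proof. by elim: s => //= -[[a|[]]|[]] s IH //=. Qed.

(** * Secure sampling *)

Section Secure.
Variables (R : realType) (X Y Z : finType) (p : X * Y * Z -> R) (P : protocol R X Y Z).
Variables (x0 : X) (y0 : Y) (z0 : Z).
Local Notation history := (history X Y Z).
Local Notation mu := (hist_pmf P).
Local Notation pr := (prob (hist_pmf P)).

(** The default outputs here and below are never reached on the support, where every party has
    halted. *)
Definition alice (h : history) : X := odflt x0 (outA h).
Definition bob (h : history) : Y := odflt y0 (outB h).
Definition charlie (h : history) : Z := odflt z0 (outC h).

Lemma outs_pad (h : history) n : terminal h -> (size h <= n)%N ->
  [/\ alice (pad n h) = alice h, bob (pad n h) = bob h & charlie (pad n h) = charlie h].
Proof.
move=> /terminal_halted/and3P[a b c] hn.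
rewrite /alice /bob /charlie /outA /outB /outC pad_cat// !map_cat.
by rewrite !first_halt_cat ?has_map.
Qed.

Lemma outs_terminal (h : history) : terminal h ->
  [/\ outA h = Some (alice h), outB h = Some (bob h) & outC h = Some (charlie h)].
Proof.
move=> /terminal_halted/and3P[a b c].
by split; apply: first_halt_some; rewrite has_map.
Qed.

Lemma outs_mix b (h h' : history) : size h = size h' -> same_cut b h h' ->
  [/\ alice (mix b h h') = alice (if b.1.1 then h' else h) /\
      haltedA (mix b h h') = haltedA (if b.1.1 then h' else h),
      bob (mix b h h') = bob (if b.1.2 then h' else h) /\
      haltedB (mix b h h') = haltedB (if b.1.2 then h' else h) &
      charlie (mix b h h') = charlie (if b.2 then h' else h) /\
      haltedC (mix b h h') = haltedC (if b.2 then h' else h)].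
Proof.
move=> s c; have [va vb vc] := views_mix s c.
rewrite /alice /bob /charlie !outA_view !outB_view !outC_view.
by rewrite !haltedA_view !haltedB_view !haltedC_view va vb vc.
Qed.

Hypothesis p_normal : normal_form p.
Hypothesis sec : secure_sampling P p.

Let valid : valid_protocol P. Proof. by case: sec. Qed.
Let kA : kernel_ok (kerA P). Proof. by case: valid. Qed.
Let kB : kernel_ok (kerB P). Proof. by case: valid. Qed.
Let kC : kernel_ok (kerC P). Proof. by case: valid. Qed.
Let codes : codes_ok P. Proof. by case: valid. Qed.
Let term : terminates P. Proof. by case: valid. Qed.
Let m0 := hist_pmf_ge0 kA kB kC.
Let m1 := hist_pmf_sum term.

Lemma links_det n :
  [/\ det mu (@tr12 X Y Z) (fun h => link12 (pad n h)),
      det mu (@tr23 X Y Z) (fun h => link23 (pad n h)) &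
      det mu (@tr31 X Y Z) (fun h => link31 (pad n h))].
Proof.
case: codes => c12 [c21 [c23 [c32 [c31 [c13 [f12 [f21 [f23 [f32 [f31 [f13 ok]]]]]]]]]]].
split; [apply: (link_pad_det kA kB kC f12 f21)|apply: (link_pad_det kA kB kC f23 f32)
  |apply: (link_pad_det kA kB kC f31 f13)] => // h r hp hh rp;
  by have [[? ? ? ?] [? ?]] := ok h r hp hh rp.
Qed.

Lemma transcript_pad (h : history) n : (size h <= n)%N ->
  [/\ tr12 (pad n h) = tr12 h, tr23 (pad n h) = tr23 h & tr31 (pad n h) = tr31 h].
Proof.
move=> hn; split; [exact: (@tr_pad X Y Z (@m12 X Y Z) (@m21 X Y Z))|
  exact: (@tr_pad X Y Z (@m23 X Y Z) (@m32 X Y Z))|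
  exact: (@tr_pad X Y Z (@m31 X Y Z) (@m13 X Y Z))].
Qed.

Definition flat (l : seq (bits * bits)) : bits := flatten [seq q.1 ++ q.2 | q <- l].

Lemma flat_link (h : history) :
  [/\ flat (link12 h) = tr12 h, flat (link23 h) = tr23 h & flat (link31 h) = tr31 h].
Proof. by rewrite /flat -!map_comp. Qed.

Ltac solve_supp :=
  apply: pr_supp => // ? /hist_pmf_gt0[/outs_terminal[? ? ?] _];
  rewrite /outs /jnt /=; split => ?;
  repeat match goal with
  | H : _ /\ _ |- _ => destruct H
  | H : and3 _ _ _ |- _ => destruct H end;
  repeat split; congruence.

Lemma law x y z : p (x, y, z) = pr [set h | [/\ alice h = x, bob h = y & charlie h = z]].
Proof.
have [_ [/(_ x y z) + _]] := sec; rewrite PrE// => -[<-].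
solve_supp.
Qed.

Lemma pXE x : pX p x = pr [set h | alice h = x].
Proof.
rewrite (pr_fiber m0 m1 (bob &&& charlie)); apply: eq_bigr => -[y z] _; rewrite law.
by congr pr; apply/seteqP; rewrite /jnt; split => h /= => [[-> -> ->]|[-> [-> ->]]].
Qed.

Lemma pYE y : pY p y = pr [set h | bob h = y].
Proof.
rewrite (pr_fiber m0 m1 (alice &&& charlie)); apply: eq_bigr => -[x z] _; rewrite law.
by congr pr; apply/seteqP; rewrite /jnt; split => h /= => [[-> -> ->]|[-> [-> ->]]].
Qed.

Lemma pZE z : pZ p z = pr [set h | charlie h = z].
Proof.
rewrite (pr_fiber m0 m1 (alice &&& bob)); apply: eq_bigr => -[x y] _; rewrite law.
by congr pr; apply/seteqP; rewrite /jnt; split => h /= => [[-> -> ->]|[-> [-> ->]]].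
Qed.

Lemma pXYE x y : pXY p (x, y) = pr [set h | alice h = x /\ bob h = y].
Proof.
rewrite (pr_fiber m0 m1 charlie); apply: eq_bigr => z _; rewrite law.
by congr pr; apply/seteqP; split => h /= => [[-> -> ->]|[[-> ->] ->]].
Qed.

Lemma pXZE x z : pXZ p (x, z) = pr [set h | alice h = x /\ charlie h = z].
Proof.
rewrite (pr_fiber m0 m1 bob); apply: eq_bigr => y _; rewrite law.
by congr pr; apply/seteqP; split => h /= => [[-> -> ->]|[[-> ->] ->]].
Qed.

Lemma pYZE y z : pYZ p (y, z) = pr [set h | bob h = y /\ charlie h = z].
Proof.
rewrite (pr_fiber m0 m1 alice); apply: eq_bigr => x _; rewrite law.
by congr pr; apply/seteqP; split => h /= => [[-> -> ->]|[[-> ->] ->]].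
Qed.


Lemma private_alice :
  cind_pt mu (bob &&& charlie) (@tr12 X Y Z &&& @tr31 X Y Z) alice.
Proof.
move=> [y z] [a c] x; have [_ [_ [/(_ x y z a c) + _]]] := sec.
rewrite !PrE// -!EFinM => -[] e; rewrite [RHS]mulrC.
move: e; congr (_ * _ = _ * _); solve_supp.
Qed.

Lemma private_bob :
  cind_pt mu (alice &&& charlie) (@tr12 X Y Z &&& @tr23 X Y Z) bob.
Proof.
move=> [x z] [a b] y; have [_ [_ [_ [/(_ x y z a b) + _]]]] := sec.
rewrite !PrE// -!EFinM => -[] e; rewrite [RHS]mulrC.
move: e; congr (_ * _ = _ * _); solve_supp.
Qed.

Lemma private_charlie :
  cind_pt mu (alice &&& bob) (@tr23 X Y Z &&& @tr31 X Y Z) charlie.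
Proof.
move=> [x y] [b c] z; have [_ [_ [_ [_ /(_ x y z b c)]]]] := sec.
rewrite !PrE// -!EFinM => -[] e; rewrite [RHS]mulrC.
move: e; congr (_ * _ = _ * _); solve_supp.
Qed.

(** The links 12 and 31 form the cut between Alice and the other two, so her moves alone may be
    exchanged once these links agree. *)
Lemma alice_det : det mu (@tr12 X Y Z &&& @tr31 X Y Z) alice.
Proof.
apply: (output_determined m0 m1 (q := bob &&& charlie)).
- apply: (rect_identity kA kB kC term (b := (true, false, false))
    (k := fun h => (link12 h, link31 h)) (ho := @haltedA X Y Z)
    (hq := fun h => haltedB h && haltedC h) (unT := fun l => (flat l.1, flat l.2))) => //.
  + move=> h h' s /= [e1 e2].
    have sc : same_cut (true, false, false) h h' by split.
    have [l1 l2 l3] := link_mix s sc; have [[a1 a2] [b1 b2] [c1 c2]] := outs_mix s sc.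
    by rewrite /jnt l1 l3 a1 a2 b1 b2 c1 c2 /= e1.
  + move=> n h h' mh mh' [e1 e2]; have [d1 d2 d3] := links_det n.
    by rewrite (d1 h h')// (d3 h h').
  + move=> h n th hn; have [a b c] := outs_pad th hn.
    have [t1 t2 t3] := transcript_pad hn; have [f1 f2 f3] := flat_link (pad n h).
    by rewrite /jnt /= f1 f3 t1 t3 a b c.
- exact: private_alice.
- move=> x x' [c [c0 cE]]; case: p_normal => + _; apply; exists c; split=> // y z.
  have := cE (y, z); rewrite !law => e; etransitivity; last (etransitivity; [exact: e|]).
    solve_supp.
  congr (_ * _); solve_supp.
Qed.

Lemma bob_det : det mu (@tr12 X Y Z &&& @tr23 X Y Z) bob.
Proof.
apply: (output_determined m0 m1 (q := alice &&& charlie)).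
- apply: (rect_identity kA kB kC term (b := (false, true, false))
    (k := fun h => (link12 h, link23 h)) (ho := @haltedB X Y Z)
    (hq := fun h => haltedA h && haltedC h) (unT := fun l => (flat l.1, flat l.2))) => //.
  + move=> h h' s /= [e1 e2].
    have sc : same_cut (false, true, false) h h' by split.
    have [l1 l2 l3] := link_mix s sc; have [[a1 a2] [b1 b2] [c1 c2]] := outs_mix s sc.
    by rewrite /jnt l1 l2 a1 a2 b1 b2 c1 c2 /= e2.
  + by move=> h; rewrite /all_halted andbCA.
  + move=> n h h' mh mh' [e1 e2]; have [d1 d2 d3] := links_det n.
    by rewrite (d1 h h')// (d2 h h').
  + move=> h n th hn; have [a b c] := outs_pad th hn.
    have [t1 t2 t3] := transcript_pad hn; have [f1 f2 f3] := flat_link (pad n h).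
    by rewrite /jnt /= f1 f2 t1 t2 a b c.
- exact: private_bob.
- move=> y y' [c [c0 cE]]; case: p_normal => _ [+ _]; apply; exists c; split=> // x z.
  have := cE (x, z); rewrite !law => e; etransitivity; last (etransitivity; [exact: e|]).
    solve_supp.
  congr (_ * _); solve_supp.
Qed.

Lemma charlie_det : det mu (@tr23 X Y Z &&& @tr31 X Y Z) charlie.
Proof.
apply: (output_determined m0 m1 (q := alice &&& bob)).
- apply: (rect_identity kA kB kC term (b := (false, false, true))
    (k := fun h => (link23 h, link31 h)) (ho := @haltedC X Y Z)
    (hq := fun h => haltedA h && haltedB h) (unT := fun l => (flat l.1, flat l.2))) => //.
  + move=> h h' s /= [e1 e2].
    have sc : same_cut (false, false, true) h h' by split.
    have [l1 l2 l3] := link_mix s sc; have [[a1 a2] [b1 b2] [c1 c2]] := outs_mix s sc.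
    by rewrite /jnt l2 l3 a1 a2 b1 b2 c1 c2 /= e2.
  + by move=> h; rewrite /all_halted andbA andbC.
  + move=> n h h' mh mh' [e1 e2]; have [d1 d2 d3] := links_det n.
    by rewrite (d2 h h')// (d3 h h').
  + move=> h n th hn; have [a b c] := outs_pad th hn.
    have [t1 t2 t3] := transcript_pad hn; have [f1 f2 f3] := flat_link (pad n h).
    by rewrite /jnt /= f2 f3 t2 t3 a b c.
- exact: private_charlie.
- move=> z z' [c [c0 cE]]; case: p_normal => _ [_ +]; apply; exists c; split=> // x y.
  have := cE (x, y); rewrite !law => e; etransitivity; last (etransitivity; [exact: e|]).
    solve_supp.
  congr (_ * _); solve_supp.
Qed.


(** The map from complete transcripts to the output is applied to the transcripts of the first n
    rounds; it can err only on runs that are not over by then. *)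
Lemma output_approx (U : Type) (u0 : U) (o : history -> U) (t1 t2 : history -> bits)
    (l1 l2 : history -> seq (bits * bits)) :
  (forall h, flat (l1 h) = t1 h) -> (forall h, flat (l2 h) = t2 h) ->
  (forall h n, (size h <= n)%N -> t1 (pad n h) = t1 h) ->
  (forall h n, (size h <= n)%N -> t2 (pad n h) = t2 h) ->
  det mu (t1 &&& t2) o ->
  exists on : nat -> history -> U,
    (forall n, det mu ((l1 \o pad n) &&& (l2 \o pad n)) (on n)) /\
    (forall n, pr [set h | o h <> on n h] <= pr [set h : history | (n < size h)%N]).
Proof.
move=> f1 f2 p1 p2 /(det_factor u0)[F FE].
exists (fun n h => F (flat (l1 (pad n h)), flat (l2 (pad n h)))); split=> n.
  by move=> h h' _ _ [-> ->].
have -> : pr [set h | o h <> F (flat (l1 (pad n h)), flat (l2 (pad n h)))] =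
    pr [set h | o h <> F (flat (l1 (pad n h)), flat (l2 (pad n h))) /\ 0 < mu h].
  by apply: pr_supp => // h mh; split => [|[]].
apply: pr_le => // h /= [ne mh]; rewrite ltnNge; apply/negP => hn; apply: ne.
by rewrite f1 f2 p1// p2// FE.
Qed.

Lemma outputs_approx :
  exists (xn : nat -> history -> X) (yn : nat -> history -> Y) (zn : nat -> history -> Z),
  [/\ forall n, [/\ det mu ((@link12 X Y Z \o pad n) &&& (@link31 X Y Z \o pad n)) (xn n),
        det mu ((@link12 X Y Z \o pad n) &&& (@link23 X Y Z \o pad n)) (yn n) &
        det mu ((@link23 X Y Z \o pad n) &&& (@link31 X Y Z \o pad n)) (zn n)] &
     forall e : R, 0 < e -> exists n, [/\ pr [set h | alice h <> xn n h] <= e,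
        pr [set h | bob h <> yn n h] <= e & pr [set h | charlie h <> zn n h] <= e]].
Proof.
have t12 h n : (size h <= n)%N -> tr12 (pad n h : history) = tr12 h.
  by case/transcript_pad.
have t23 h n : (size h <= n)%N -> tr23 (pad n h : history) = tr23 h.
  by case/transcript_pad.
have t31 h n : (size h <= n)%N -> tr31 (pad n h : history) = tr31 h.
  by case/transcript_pad.
have f12 (h : history) : flat (link12 h) = tr12 h by case: (flat_link h).
have f23 (h : history) : flat (link23 h) = tr23 h by case: (flat_link h).
have f31 (h : history) : flat (link31 h) = tr31 h by case: (flat_link h).
have [xn [xd xp]] := output_approx x0 f12 f31 t12 t31 alice_det.
have [yn [yd yp]] := output_approx y0 f12 f23 t12 t23 bob_det.
have [zn [zd zp]] := output_approx z0 f23 f31 t23 t31 charlie_det.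
exists xn, yn, zn; split=> // e e0; have [n Nn] := tail_small kA kB kC term e0.
by exists n; split; [apply: le_trans (xp n) _|apply: le_trans (yp n) _|
  apply: le_trans (zp n) _]; apply: Nn.
Qed.

Lemma transcript_entropies :
  [/\ H12 P = cond_entropy mu (@tr12 X Y Z) (@const_rv history),
      H23 P = cond_entropy mu (@tr23 X Y Z) (@const_rv history) &
      H31 P = cond_entropy mu (@tr31 X Y Z) (@const_rv history)].
Proof.
by split; apply/esym; apply: ent_esum => // t; rewrite PrE.
Qed.

Lemma cond_entropies :
  [/\ cond_entropy mu (bob &&& charlie) alice = (Hfin p - Hfin (pX p))%:E,
      cond_entropy mu (charlie &&& alice) bob = (Hfin p - Hfin (pY p))%:E &
      cond_entropy mu (alice &&& bob) charlie = (Hfin p - Hfin (pZ p))%:E].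
Proof.
have HJ : cond_entropy mu (alice &&& bob &&& charlie) (@const_rv history) = (Hfin p)%:E.
  by apply: ent_Hfin => // -[[x y] z]; rewrite law; solve_supp.
have split_ent (S : Type) (U : finType) (f : history -> S) (x : history -> U) (q : U -> R) :
    (forall u, q u = pr [set h | x h = u]) ->
    cond_entropy mu (alice &&& bob &&& charlie) (@const_rv history) =
    cond_entropy mu (f &&& x) (@const_rv history) -> cond_entropy mu f x = (Hfin p - Hfin q)%:E.
  move=> qE; rewrite HJ condH_chain// (ent_Hfin m0 m1 qE) => e.
  rewrite (@condH_eq _ _ _ m0 m1 _ _ _ _ f x f (x &&& @const_rv history)); try solve_det.
  by move: e; case: (cond_entropy _ _ _) => [t| |]//; rewrite -EFinD => -[->]; rewrite addrK.
split; apply: split_ent; first [exact: pXE|exact: pYE|exact: pZE|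
  by apply: condH_eq => //; solve_det].
Qed.

Let sw (S T : Type) (k : S * T) := (k.2, k.1).

Lemma secure_sampling_bound :
  [/\ ((RI (pXZ p) + RI (pXY p) + (Hfin p - Hfin (pX p)))%:E <= H23 P)%E,
      ((RI (pYZ p) + RI (pXY p) + (Hfin p - Hfin (pY p)))%:E <= H31 P)%E &
      ((RI (pXZ p) + RI (pYZ p) + (Hfin p - Hfin (pZ p)))%:E <= H12 P)%E].
Proof.
have [-> -> ->] := transcript_entropies; have [cX cY cZ] := cond_entropies.
have [xn [yn [zn [dn approx]]]] := outputs_approx.
have inter n := interaction3_links kA kB kC term n.
have pa := private_alice; have pb := private_bob; have pc := private_charlie.
have pmap (S T S' T' : choiceType) (U : Type) (f : history -> S) (g : history -> T)
    (k : history -> U) (F : S -> S') (G : T -> T') :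
    cind_pt mu f g k -> cind_pt mu (G \o g) (F \o f) k.
  move=> h; apply: cind_pt_map => //; apply: cind_pt_sym; exact: cind_pt_map.
have [xz zx] := RI_bound m0 m1 pXZE (pmap _ _ _ _ _ _ _ _ snd snd pa)
  (pmap _ _ _ _ _ _ _ _ fst snd pc).
have [xy yx] := RI_bound m0 m1 pXYE (pmap _ _ _ _ _ _ _ _ fst fst pa)
  (pmap _ _ _ _ _ _ _ _ fst fst pb).
have [yz zy] := RI_bound m0 m1 pYZE (pmap _ _ _ _ _ _ _ _ snd snd pb)
  (pmap _ _ _ _ _ _ _ _ snd fst pc).
have l12 n : det mu (@tr12 X Y Z) (@link12 X Y Z \o pad n) by case: (links_det n).
have l23 n : det mu (@tr23 X Y Z) (@link23 X Y Z \o pad n) by case: (links_det n).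
have l31 n : det mu (@tr31 X Y Z) (@link31 X Y Z \o pad n) by case: (links_det n).
have detC (S T U : Type) (f : history -> S) (g : history -> T) (k : history -> U) :
    det mu (f &&& g) k -> det mu (g &&& f) k.
  by move=> d h h' mh mh' e; apply: d => //; case: e => e1 e2; rewrite /jnt e1 e2.
have dxn n : det mu ((@link12 X Y Z \o pad n) &&& (@link31 X Y Z \o pad n)) (xn n).
  by case: (dn n).
have dyn n : det mu ((@link12 X Y Z \o pad n) &&& (@link23 X Y Z \o pad n)) (yn n).
  by case: (dn n).
have dzn n : det mu ((@link23 X Y Z \o pad n) &&& (@link31 X Y Z \o pad n)) (zn n).
  by case: (dn n).
(* The three bounds are one, under the cyclic rotation of the links 12, 23, 31 together with the
   parties; [sw] and [detC] restore the order of pairs. *)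
split.
- rewrite EFinD -cX; apply: (transcript_bound m0 m1
    (A := @tr12 X Y Z) (B := @tr23 X Y Z) (C := @tr31 X Y Z)
    (An := fun n => @link12 X Y Z \o pad n) (Bn := fun n => @link23 X Y Z \o pad n)
    (Cn := fun n => @link31 X Y Z \o pad n) (xn := xn) (zn := zn)
    alice_det bob_det charlie_det pa _ l12 l23 l31 dxn dzn _ zx yx).
  + by move=> n; have [i _ _] := inter n; exact: i.
  + by move=> e /approx[n [ex _ ez]]; exists n.
- rewrite [RI (pYZ p) + _]addrC EFinD -cY; apply: (transcript_bound m0 m1
    (A := @tr23 X Y Z) (B := @tr31 X Y Z) (C := @tr12 X Y Z)
    (An := fun n => @link23 X Y Z \o pad n) (Bn := fun n => @link31 X Y Z \o pad n)
    (Cn := fun n => @link12 X Y Z \o pad n) (xn := yn) (zn := xn)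
    (detC _ _ _ _ _ _ bob_det) charlie_det (detC _ _ _ _ _ _ alice_det)
    (cind_pt_sym (pmap _ _ _ _ _ _ _ _ (@sw _ _) (@sw _ _) pb)) _ l23 l31 l12
    (fun n => detC _ _ _ _ _ _ (dyn n)) (fun n => detC _ _ _ _ _ _ (dxn n)) _ xy zy).
  + by move=> n; have [_ i _] := inter n; exact: i.
  + by move=> e /approx[n [ex ey _]]; exists n.
- rewrite [RI (pXZ p) + _]addrC EFinD -cZ; apply: (transcript_bound m0 m1
    (A := @tr31 X Y Z) (B := @tr12 X Y Z) (C := @tr23 X Y Z)
    (An := fun n => @link31 X Y Z \o pad n) (Bn := fun n => @link12 X Y Z \o pad n)
    (Cn := fun n => @link23 X Y Z \o pad n) (xn := zn) (zn := yn)
    (detC _ _ _ _ _ _ charlie_det) (detC _ _ _ _ _ _ alice_det) bob_det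
    (cind_pt_sym (pmap _ _ _ _ _ _ _ _ id (@sw _ _) pc)) _ l31 l12 l23
    (fun n => detC _ _ _ _ _ _ (dzn n)) dyn _ yz xz).
  + by move=> n; have [_ _ i] := inter n; exact: i.
  + by move=> e /approx[n [_ ey ez]]; exists n.
Qed.

End Secure.

Theorem theorem9 (R : realType) (X Y Z : finType) (p : X * Y * Z -> R) :
  is_pmf p -> normal_form p ->
  forall P : protocol R X Y Z, secure_sampling P p ->
  [/\ ((RI (pXZ p) + RI (pXY p) + (Hfin p - Hfin (pX p)))%:E <= H23 P)%E,
      ((RI (pYZ p) + RI (pXY p) + (Hfin p - Hfin (pY p)))%:E <= H31 P)%E &
      ((RI (pXZ p) + RI (pYZ p) + (Hfin p - Hfin (pZ p)))%:E <= H12 P)%E].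
Proof.
move=> [_ p1] nf P sec.
(* The default outputs need a point in each alphabet; an empty product would contradict total mass
   1. *)
case: (pickP (fun _ : X * Y * Z => true)) => [[[x0 y0] z0] _|noXYZ].
  exact: (secure_sampling_bound x0 y0 z0 nf sec).
move: p1; rewrite big1 => [/esym/eqP|t _]; first by rewrite oner_eq0.
by have := noXYZ t.
Qed.
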